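(* Let $\alpha$ be a composition and let $(P,\gamma)$ be a labeled poset. Then $$\omega(L^{(\beta)}_\alpha)=L^{(\beta)}_{\alpha^{\mathtt t}}(\tfrac{x}{1-\beta x}),\qquad\psi(L^{(\beta)}_\alpha)=L^{(\beta)}_{\alpha^{\mathtt c}}(\tfrac{x}{1-\beta x}),\qquad\rho(L^{(\beta)}_\alpha)=L^{(\beta)}_{\alpha^{\mathtt r}},$$ and $$\omega(\Gamma^{(\beta)}(P,\gamma))=\Gamma^{(\beta)}(P^*,\gamma)(\tfrac{x}{1-\beta x}),\qquad\psi(\Gamma^{(\beta)}(P,\gamma))=\Gamma^{(\beta)}(P,\gamma^* )(\tfrac{x}{1-\beta x}),\qquad\rho(\Gamma^{(\beta)}(P,\gamma))=\Gamma^{(\beta)}(P^*,\gamma^* ).$$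
   Context: $f(\frac{x}{1-\beta x})$ denotes the power series obtained from $f\in\mathbb{Z}[\beta][[x_1,x_2,\dots]]$ by substituting $x_i\mapsto\frac{x_i}{1-\beta x_i}$ for every $i$. Compositions. A composition $\alpha=(\alpha_1,\dots,\alpha_k)$ is a finite sequence of positive integers, $|\alpha|=\sum\alpha_i$, $I(\alpha)=\{\alpha_1,\alpha_1+\alpha_2,\dots,\alpha_1+\cdots+\alpha_{k-1}\}$. With $n=|\alpha|$: $\alpha^{\mathtt r}$ is the reversal of $\alpha$, $\alpha^{\mathtt c}$ is the composition of $n$ with $I(\alpha^{\mathtt c})=[n-1]\setminus I(\alpha)$, and $\alpha^{\mathtt t}=(\alpha^{\mathtt c})^{\mathtt r}$. Set-valued generating functions. For finite nonempty $S,T\subset\mathbb{Z}_{>0}$: $S\prec T$ means $\max S<\min T$, $S\preceq T$ means $\max S\le\min T$, $x^S=\prod_{i\in S}x_i$. For $|\alpha|=N$, the multifundamental quasisymmetric function is $L^{(\beta)}_\alpha=\sum\beta^{\sum|S_i|-N}\prod_ix^{S_i}$ over tuples $S_1\preceq\cdots\preceq S_N$ of finite nonempty subsets of $\mathbb{Z}_{>0}$ with $S_i\prec S_{i+1}$ if $i\in I(\alpha)$. Put $L_\alpha=L^{(0)}_\alpha$ (set $\beta=0$). A labeled poset $(P,\gamma)$ is a finite poset with an injective map $\gamma:P\to\mathbb{Z}$; $s\lessdot t$ means $t$ covers $s$. A set-valued $(P,\gamma)$-partition is a map $\sigma$ from $P$ to finite nonempty subsets of $\mathbb{Z}_{>0}$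 such that for each cover $s\lessdot t$, $\sigma(s)\preceq\sigma(t)$, and $\sigma(s)\prec\sigma(t)$ if $\gamma(s)>\gamma(t)$. $\Gamma^{(\beta)}(P,\gamma)=\sum_\sigma\beta^{|\sigma|-|P|}x^\sigma$ with $|\sigma|=\sum_{s\in P}|\sigma(s)|$, $x^\sigma=\prod_{s\in P}x^{\sigma(s)}$. $P^*$ is the dual poset (all order relations reversed) and $\gamma^*(s)=-\gamma(s)$. Involutions. $\mathfrak{m}\mathrm{QSym}$ is the module of all quasisymmetric power series over $\mathbb{Z}[\beta]$ (unbounded degree allowed), consisting of all possibly infinite $\mathbb{Z}[\beta]$-linear combinations of the $L_\alpha$. $\omega,\psi,\rho:\mathfrak{m}\mathrm{QSym}\to\mathfrak{m}\mathrm{QSym}$ are the continuous linear maps (compatible with infinite linear combinations of the $L_\alpha$) with $\omega(L_\alpha)=L_{\alpha^{\mathtt t}}$, $\psi(L_\alpha)=L_{\alpha^{\mathtt c}}$, $\rho(L_\alpha)=L_{\alpha^{\mathtt r}}$. *)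

(* Defs.v *)
From HB Require Import structures.
From mathcomp Require Import all_boot all_order all_algebra.
From mathcomp Require Import finmap.
From mathcomp Require Import mathcomp_extra boolp classical_sets functions.
From mathcomp Require Import cardinality fsbigop.
From mathcomp Require Import monalg.

Set Implicit Arguments.
Unset Strict Implicit.
Unset Printing Implicit Defensive.

Import Order.TTheory GRing.Theory Num.Theory.

Local Open Scope classical_set_scope.
Local Open Scope ring_scope.

(* Compositions *)

Record composition := Composition {
  parts :> seq nat;
  parts_gt0 : all (leq 1) parts }.

HB.instance Definition _ := [isSub for parts].
HB.instance Definition _ := [Countable of composition by <:].

Definition descents (a : seq nat) : seq nat :=
  [seq sumn (take i a) | i <- iota 1 (size a).-1].

(* The composition of [n] whose partial sums are the elements of the strictly
   increasing sequence [s] in [1, n - 1], followed by [n]. *)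
Definition comp_of_descents (n : nat) (s : seq nat) : seq nat :=
  if n is 0%N then [::] else pairmap (fun i j => (j - i)%N) 0%N (rcons s n).

Definition compl_descents (a : seq nat) : seq nat :=
  [seq i <- iota 1 (sumn a).-1 | i \notin descents a].

Lemma pairmap_sub_gt0 i s :
  path ltn i s -> all (leq 1) (pairmap (fun i j => (j - i)%N) i s).
Proof.
elim: s i => //= j s IHs i /andP[ltij /IHs->]; by rewrite subn_gt0 ltij.
Qed.

Lemma path_compl_descents (a : seq nat) : (0 < sumn a)%N ->
  path ltn 0%N (rcons (compl_descents a) (sumn a)).
Proof.
move=> a0; rewrite -cats1 cat_path /= andbT; apply/andP; split.
  rewrite (path_sortedE ltn_trans) sorted_filter ?iota_ltn_sorted ?andbT //.
    by apply/allP=> i; rewrite mem_filter mem_iota => /and3P[].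
  exact: ltn_trans.
have : last 0%N (compl_descents a) \in 0%N :: compl_descents a by apply: mem_last.
rewrite inE => /orP[/eqP-> //|].
by rewrite mem_filter mem_iota; case: (sumn a) a0 => //= n _ /and3P[].
Qed.

Lemma compl_parts_gt0 (a : seq nat) :
  all (leq 1) (comp_of_descents (sumn a) (compl_descents a)).
Proof.
rewrite /comp_of_descents; case E: (sumn a) => [//|n]; rewrite -E.
by apply/pairmap_sub_gt0/path_compl_descents; rewrite E.
Qed.

Lemma rev_parts_gt0 (a : composition) : all (leq 1) (rev a).
Proof. by rewrite all_rev parts_gt0. Qed.

Definition comp_rev (a : composition) : composition :=
  Composition (rev_parts_gt0 a).
Definition comp_compl (a : composition) : composition :=
  Composition (compl_parts_gt0 a).
Definition comp_transpose (a : composition) : composition :=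
  comp_rev (comp_compl a).

Lemma sumn_take_pairmap_sub i0 s i : path ltn i0 s -> (i <= size s)%N ->
  (i0 + sumn (take i (pairmap (fun i j => (j - i)%N) i0 s)))%N = nth 0%N (i0 :: s) i.
Proof.
elim: s i0 i => [|j s IHs] i0 [|i] //=; rewrite ?addn0 // => /andP[lt_ij ps] li.
by rewrite addnA (subnKC (ltnW lt_ij)) IHs.
Qed.

Lemma sumn_comp_compl (a : composition) : sumn (comp_compl a) = sumn a.
Proof.
rewrite /= /comp_of_descents; case E: (sumn a) => [//|n]; rewrite -E.
have pth := @path_compl_descents a; rewrite E in pth; have {}pth := pth isT.
have := sumn_take_pairmap_sub pth (leqnn _); rewrite add0n -E => H.
rewrite take_oversize ?size_pairmap // in H; rewrite H size_rcons /=.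
by rewrite nth_rcons ltnn eqxx.
Qed.

Lemma mem_descents_compl (a : composition) i :
  (i \in descents (comp_compl a)) =
  (0 < i < sumn a)%N && (i \notin descents a).
Proof.
rewrite {1}/descents /= /comp_of_descents; case E: (sumn a) => [|n].
  by rewrite ltn0 andbF.
rewrite size_pairmap size_rcons /= -E.
have pth := @path_compl_descents a; rewrite E in pth; have {}pth := pth isT.
set s := compl_descents a in pth *.
have -> : [seq sumn (take i (pairmap (fun i j => (j - i)%N) 0%N (rcons s (sumn a))))
    | i <- iota 1 (size s)] = s.
  apply: (@eq_from_nth _ 0%N) => [|k]; rewrite size_map size_iota // => lk.
  rewrite (nth_map 0%N) ?size_iota // nth_iota // add1n E.
  have := @sumn_take_pairmap_sub 0%N _ k.+1 pth; rewrite add0n => -> //=.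
    by rewrite nth_rcons lk.
  by rewrite size_rcons ltnS ltnW.
rewrite /s /compl_descents mem_filter mem_iota E /= add1n ltnS andbC.
by rewrite -ltnS.
Qed.

(* Power series over Z[beta] in countably many variables.  The variable
   x_{i+1} of the paper has index i : nat, so that nat, with its order, stands
   for the index set of positive integers. *)

Notation Zbeta := {poly int}.
Notation beta := ('X : {poly int}).
Notation monomial := {cmonom nat}.

Definition fps := monomial -> Zbeta.

HB.instance Definition _ := GRing.Lmodule.copy fps (monomial -> Zbeta^o).

Definition fps_one : fps := fun m => (m == mone)%:R.
Definition fps_mul (f g : fps) : fps := fun m =>
  \sum_(p \in [set p : monomial * monomial | mmul p.1 p.2 = m]) f p.1 * g p.2.

Lemma finite_divisors (m : monomial) :
  finite_set [set a : monomial | forall i, (a i <= m i)%N].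
Proof.
pose N := (\max_(i <- finsupp m) m i).+1.
have mN i : (m i < N)%N.
  rewrite ltnS; case: (finsuppP m i) => // im.
  by rewrite (big_rem i) //= leq_maxl.
pose F (g : {ffun finsupp m -> 'I_N}) : monomial :=
  (mkcmonom [fsfun i : finsupp m => nat_of_ord (g i) | 0%N])%M.
apply: (@sub_finite_set _ _ (F @` setT)); last exact: finite_image.
move=> a am; exists [ffun i : finsupp m => inord (a (val i))] => //.
apply/eqP/cmP=> i; rewrite cmE fsfun_ffun.
case: insubP => [[j jm] _ /= <-|im]; rewrite ?ffunE /=.
  by rewrite inordK //; apply: leq_ltn_trans (am _) (mN _).
by move: (am i); rewrite (fsfun_dflt im) leqn0 => /eqP.
Qed.

Definition divisors_of (m : monomial) : {fset monomial} :=
  fset_set [set a : monomial | forall i, (a i <= m i)%N].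

Lemma in_divisors_of (m a : monomial) :
  reflect (forall i, (a i <= m i)%N) (a \in divisors_of m).
Proof.
rewrite in_fset_set; last exact: finite_divisors.
by apply: (iffP idP); rewrite in_setE.
Qed.

Lemma fps_mulE (f g : fps) (d m : monomial) : d \in divisors_of m ->
  fps_mul f g d = \sum_(a <- divisors_of m) \sum_(b <- divisors_of m)
     (f a * g b) *+ (mmul a b == d).
Proof.
move=> /in_divisors_of dm; rewrite /fps_mul.
have ab_div (a b : monomial) : mmul a b = d ->
    (a \in divisors_of m) && (b \in divisors_of m).
  move=> abd; apply/andP; split; apply/in_divisors_of => i;
    apply: leq_trans (dm i); by rewrite -abd cmM ?leq_addr ?leq_addl.
set D := divisors_of m in ab_div *.
have -> : \sum_(a <- D) \sum_(b <- D) (f a * g b) *+ (mmul a b == d) =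
    \sum_(p <- [seq (a, b) | a <- D, b <- D] | mmul p.1 p.2 == d) f p.1 * g p.2.
  by rewrite [RHS]big_mkcond big_allpairs; do 2!apply: eq_bigr => ? _;
    rewrite mulrb.
rewrite [RHS]bigfs.
- by apply: eq_fsbigl; apply/seteqP; split=> p /eqP.
- by apply: allpairs_uniq => // -[a b] [a' b'] _ _ [-> ->].
by move=> [a b] /= /eqP/ab_div/andP[aD bD]; rewrite allpairs_f.
Qed.

Lemma divisors_of_refl m : m \in divisors_of m.
Proof. exact/in_divisors_of. Qed.

Lemma divisors_of_mulr a b m :
  mmul a b \in divisors_of m -> b \in divisors_of m.
Proof.
by move=> /in_divisors_of H; apply/in_divisors_of => i;
  apply: leq_trans (H i); rewrite cmM leq_addl.
Qed.

Lemma divisors_of_mull a b m :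
  mmul a b \in divisors_of m -> a \in divisors_of m.
Proof. rewrite mulmC; exact: divisors_of_mulr. Qed.

Lemma sum_divisors_eq (m c : monomial) (F : monomial -> Zbeta) :
  (c \notin divisors_of m -> F c = 0) ->
  \sum_(d <- divisors_of m) F d *+ (c == d) = F c.
Proof.
move=> Fc; have [cm|cm] := boolP (c \in divisors_of m).
  rewrite (big_fsetD1 c) //= eqxx mulr1n big1_seq ?addr0 // => d.
  by rewrite in_fsetD1 => /andP[_ /andP[/negPf dc _]]; rewrite eq_sym dc.
rewrite Fc // big1_seq // => d /andP[_ dm].
by case: eqP => // cd; rewrite cd dm in cm.
Qed.

Fact fps_mulC : commutative fps_mul.
Proof.
move=> f g; apply/funext=> m; rewrite !(fps_mulE _ _ (divisors_of_refl m)).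
rewrite exchange_big; apply: eq_bigr => a _; apply: eq_bigr => b _.
by rewrite mulrC mulmC.
Qed.

Fact fps_mulDl : left_distributive fps_mul +%R.
Proof.
move=> f g h; apply/funext=> m.
rewrite -[RHS]/(fps_mul f h m + fps_mul g h m).
rewrite !(fps_mulE _ _ (divisors_of_refl m)) -big_split /=.
apply: eq_bigr => a _; rewrite -big_split /=.
by apply: eq_bigr => b _; rewrite -mulrnDl -mulrDl.
Qed.

Fact fps_mul1 : left_id fps_one fps_mul.
Proof.
move=> f; apply/funext=> m; rewrite (fps_mulE _ _ (divisors_of_refl m)).
rewrite (big_fsetD1 mone) /=; last by apply/in_divisors_of => i; rewrite cm1.
rewrite [X in _ + X]big1_seq ?addr0 => [|a].
  rewrite -[RHS](@sum_divisors_eq m m); last by rewrite divisors_of_refl.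
  apply: eq_bigr => b _; rewrite /fps_one eqxx mul1r mul1m.
  by have [->|] := eqVneq b m.
rewrite in_fsetD1 => /andP[_ /andP[/negPf a1 _]].
by rewrite big1 // => b _; rewrite /fps_one a1 mul0r mul0rn.
Qed.

Fact fps_mulA : associative fps_mul.
Proof.
have triple (f g h : fps) m : fps_mul f (fps_mul g h) m =
    \sum_(a <- divisors_of m) \sum_(b <- divisors_of m)
      \sum_(c <- divisors_of m) (f a * (g b * h c)) *+ (mmul a (mmul b c) == m).
  rewrite (fps_mulE _ _ (divisors_of_refl m)); apply: eq_bigr => a _.
  under eq_big_seq => d dm.
    rewrite (fps_mulE _ _ dm) mulr_sumr -sumrMnl.
    under eq_bigr do (rewrite mulr_sumr -sumrMnl; under eq_bigr do
      rewrite mulrnAr -mulrnA mulnC mulrnA).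
    over.
  rewrite exchange_big; apply: eq_bigr => b _.
  rewrite exchange_big; apply: eq_bigr => c _ /=.
  rewrite (@sum_divisors_eq m (mmul b c)
    (fun d => (f a * (g b * h c)) *+ (mmul a d == m))) //.
  move=> /negP bcm; case: eqP => // abc; case: bcm.
  by apply: (@divisors_of_mulr a); rewrite abc divisors_of_refl.
move=> f g h; apply/funext=> m; rewrite [fps_mul (fps_mul f g) h]fps_mulC !triple.
rewrite [RHS]exchange_big; apply: eq_bigr => a _.
rewrite [RHS]exchange_big; apply: eq_bigr => b _; apply: eq_bigr => c _ /=.
by rewrite [mmul c _]mulmC mulmA [h c * _]mulrC mulrA.
Qed.

Fact fps_one_neq0 : fps_one != 0.
Proof.
by apply/eqP => /(congr1 (@^~ mone)); rewrite /fps_one eqxx => /eqP; rewrite oner_eq0.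
Qed.

HB.instance Definition _ := GRing.Zmodule_isComNzRing.Build fps
  fps_mulA fps_mulC fps_mul1 fps_mulDl fps_one_neq0.

Fact fps_scaleAl (c : Zbeta) (f g : fps) : c *: (f * g) = c *: f * g.
Proof.
apply/funext=> m; rewrite -[LHS]/(c * fps_mul f g m).
rewrite -[RHS]/(fps_mul (c *: f) g m) !(fps_mulE _ _ (divisors_of_refl m)).
rewrite mulr_sumr; apply: eq_bigr => a _; rewrite mulr_sumr.
by apply: eq_bigr => b _; rewrite mulrnAr mulrA.
Qed.

HB.instance Definition _ := GRing.Lmodule_isLalgebra.Build Zbeta fps fps_scaleAl.
HB.instance Definition _ := GRing.Lalgebra_isComAlgebra.Build Zbeta fps.

Definition fps_var (i : nat) : fps := fun m => (m == ucm i)%:R.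

(* x_i / (1 - beta x_i) = sum_{j >= 1} beta^{j-1} x_i^j; it is the only power
   series whose product by 1 - beta x_i is x_i (see geom_varE). *)
Definition geom_var (i : nat) : fps := fun m =>
  if finsupp m == [fset i]%fset then beta ^+ (m i).-1 else 0.

(* The junk value of a sum with infinite support is 0: the substitution is
   meaningful when each monomial occurs in finitely many of the products below,
   as it does for y = geom_var. *)
Definition fps_subst (y : nat -> fps) (f : fps) : fps := fun m =>
  \sum_(k \in [set: monomial]) f k * (\prod_(i <- finsupp k) y i ^+ k i) m.

Lemma fps_varM i f m :
  (fps_var i * f) m = if (0 < m i)%N then f (divcm m (ucm i)) else 0.
Proof.
rewrite [LHS](fps_mulE _ _ (divisors_of_refl m)).
case: ifPn => [mi|]; last first.
  rewrite -eqn0Ngt => /eqP mi; rewrite big1 // => a _; rewrite big1 // => b _.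
  rewrite /fps_var; case: eqP => [->|_]; last by rewrite mul0r mul0rn.
  case: eqP => // ab; move: mi; rewrite -ab cmM cmUU => //.
have e : mmul (ucm i) (divcm m (ucm i)) = m.
  apply/eqP/cmP=> j; rewrite cmM divcmE subnKC // cmU.
  by case: eqP => // <-.
rewrite (big_fsetD1 (ucm i)) /=; last first.
  by apply: (@divisors_of_mull _ (divcm m (ucm i))); rewrite e divisors_of_refl.
rewrite [X in _ + X]big1_seq ?addr0 => [|a]; last first.
  rewrite in_fsetD1 => /andP[_ /andP[/negPf ai _]].
  by rewrite big1 // => b _; rewrite /fps_var ai mul0r mul0rn.
rewrite -[RHS](@sum_divisors_eq m (divcm m (ucm i))); last first.
  by case/negP; apply: (@divisors_of_mulr (ucm i)); rewrite e divisors_of_refl.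
apply: eq_bigr => b _; rewrite /fps_var eqxx mul1r.
suff -> : (mmul (ucm i) b == m) = (divcm m (ucm i) == b) by [].
apply/eqP/eqP => [<-|<- //].
by apply/eqP/cmP=> j; rewrite divcmE cmM addKn.
Qed.

Lemma geom_varE i : geom_var i * (1 - beta *: fps_var i) = fps_var i.
Proof.
rewrite mulrBr mulr1 -scalerAr [_ * fps_var i]mulrC; apply/funext=> m.
rewrite -[LHS]/(geom_var i m - beta * (fps_var i * geom_var i) m) fps_varM.
have eqU : (finsupp m == [fset i]%fset) && (m i == 1%N) = (m == ucm i).
  apply/andP/eqP => [[/eqP mi /eqP m1]|->]; last first.
    by rewrite (mdomU i) cmUU.
  apply/eqP/cmP=> j; rewrite cmU; case: eqP => [<- //|/eqP ij].
  by apply/eqP; rewrite cmE_eq0 mi in_fset1 eq_sym.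
have [mi|] := ltnP 0 (m i); last first.
  rewrite leqn0 => /eqP mi; rewrite mulr0 subr0 /geom_var /fps_var -eqU mi andbF.
  case: eqP => // fm; move/eqP: mi; rewrite cmE_eq0 fm in_fset1 eqxx //.
rewrite /geom_var /fps_var -eqU divcmE cmUU.
have [m1|m1] := eqVneq (m i) 1%N.
  rewrite m1 expr0 andbT [X in _ * X]ifF ?mulr0 ?subr0; first by case: ifP.
  apply/negP => /eqP/fsetP/(_ i); rewrite in_fset1 eqxx -cmE_neq0 divcmE cmUU.
  by rewrite m1.
rewrite andbF (_ : (finsupp (divcm m (ucm i)) == _) = (finsupp m == [fset i]%fset)).
  case: ifP => _; last by rewrite mulr0 subrr.
  by rewrite -exprS subn1 prednK ?subrr // -subn1 subn_gt0 ltn_neqAle eq_sym m1.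
suff -> : finsupp (divcm m (ucm i)) = finsupp m by [].
apply/fsetP=> j; rewrite -!cmE_neq0 divcmE cmU; have [<-|_] := eqVneq i j; last by rewrite subn0.
by case: (m i) m1 mi => [|[|n]].
Qed.

(* Quasisymmetric power series *)

(* The exponents (a_1, ..., a_k) of a monomial x_{i_1}^{a_1} ... x_{i_k}^{a_k}
   with i_1 < ... < i_k and all a_j > 0. *)
Definition exponents (m : monomial) : seq nat :=
  [seq m i | i <- sort leq (finsupp m)].

Definition quasisymmetric (f : fps) : Prop :=
  forall m m', exponents m = exponents m' -> f m = f m'.

Definition qsym_pred : {pred fps} := fun f => `[< quasisymmetric f >].

Fact qsym_submod_closed : submod_closed qsym_pred.
Proof.
split=> [|c f g /asboolP fq /asboolP gq]; apply/asboolP => m m' e //.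
by rewrite -[LHS]/(c * f m + g m) (fq _ _ e) (gq _ _ e).
Qed.

HB.instance Definition _ :=
  GRing.isSubmodClosed.Build Zbeta fps qsym_pred qsym_submod_closed.

Record mQSym := MQSym { mQSym_val :> fps; mQSymP : mQSym_val \in qsym_pred }.

Arguments mQSym_val : simpl never.

HB.instance Definition _ := [isSub for mQSym_val].
HB.instance Definition _ := [Choice of mQSym by <:].
HB.instance Definition _ := [SubChoice_isSubLmodule of mQSym by <:].

(* Set-valued generating functions *)

Definition set_monomial (S : {fset nat}) : monomial :=
  \big[mmul/mone]_(i <- S) ucm i.

Definition sv_monomial (T : finType) (s : {ffun T -> {fset nat}}) : monomial :=
  \big[mmul/mone]_(t : T) set_monomial (s t).

Definition sv_size (T : finType) (s : {ffun T -> {fset nat}}) : nat :=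
  (\sum_(t : T) #|` s t|)%N.

(* Both relations are only used between nonempty sets; they then say that
   max S < min T and max S <= min T. *)
Definition set_lt (S T : {fset nat}) : Prop :=
  forall i j, i \in S -> j \in T -> (i < j)%N.
Definition set_le (S T : {fset nat}) : Prop :=
  forall i j, i \in S -> j \in T -> (i <= j)%N.

(* sum_{s in A} b^{|s| - |T|} x^s; the coefficient of each monomial is a finite
   sum, and |T| <= |s| when all the s t are nonempty. *)
Definition sv_gf (b : Zbeta) (T : finType)
    (A : set {ffun T -> {fset nat}}) : fps := fun m =>
  \sum_(s \in [set s | A s /\ sv_monomial s = m]) b ^+ (sv_size s - #|T|).

(* The tuple (S_1, ..., S_N) is indexed from 0, so that S_i is [s j] for j = i - 1
   and the condition on S_i and S_{i+1} is about the ordinals i - 1 and i. *)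
Definition comp_tuples (a : composition) :
    set {ffun 'I_(sumn a) -> {fset nat}} :=
  [set s | (forall i, s i != fset0) /\
     forall i j : 'I_(sumn a), j = i.+1 :> nat ->
       set_le (s i) (s j) /\
       ((j : nat) \in descents a -> set_lt (s i) (s j))].

Arguments comp_tuples a : clear implicits.

Definition covers (d : Order.disp_t) (P : finPOrderType d) (s t : P) : bool :=
  (s < t)%O && ~~ [exists u : P, (s < u)%O && (u < t)%O].

Definition sv_partitions (d : Order.disp_t) (P : finPOrderType d)
    (gamma : P -> int) : set {ffun P -> {fset nat}} :=
  [set s | (forall t, s t != fset0) /\
     forall t u : P, covers t u ->
       set_le (s t) (s u) /\ (gamma u < gamma t -> set_lt (s t) (s u))].

Definition relabel (T : finType) (h : nat -> nat) (s : {ffun T -> {fset nat}}) :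
    {ffun T -> {fset nat}} :=
  [ffun t => [fset h i | i in s t]%fset].

Definition relabel_closed (T : finType) (A : set {ffun T -> {fset nat}}) : Prop :=
  forall (h : nat -> nat) (s : {ffun T -> {fset nat}}),
    (forall t u i j, i \in s t -> j \in s u -> (h i < h j)%N = (i < j)%N) ->
    A s -> A (relabel h s).

Lemma set_monomialE S i : set_monomial S i = (i \in S).
Proof.
rewrite /set_monomial (big_morph (fun m : monomial => m i) (cmM i) (cm1 i)).
case: (boolP (i \in S)) => iS.
  rewrite (big_fsetD1 i) //= cmUU big1_seq // => j.
  by rewrite in_fsetD1 cmU => /andP[_ /andP[/negPf->]].
rewrite big1_seq // => j /andP[_ jS]; rewrite cmU.
by case: eqP => // ji; rewrite -ji jS in iS.
Qed.

Lemma sv_monomialE (T : finType) (s : {ffun T -> {fset nat}}) i :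
  sv_monomial s i = (\sum_(t : T) (i \in s t))%N.
Proof.
rewrite /sv_monomial (big_morph (fun m : monomial => m i) (cmM i) (cm1 i)).
by apply: eq_bigr => t _; rewrite set_monomialE.
Qed.

Lemma sv_monomial_supp (T : finType) (s : {ffun T -> {fset nat}}) t i :
  i \in s t -> i \in finsupp (sv_monomial s).
Proof.
by move=> ist; rewrite -cmE_neq0 sv_monomialE (bigD1 t) //= ist.
Qed.

Definition match_vars (m m' : monomial) (i : nat) : nat :=
  nth 0%N (sort leq (finsupp m')) (index i (sort leq (finsupp m))).

Lemma sorted_supp (m : monomial) : sorted ltn (sort leq (finsupp m)).
Proof.
by rewrite ltn_sorted_uniq_leq sort_uniq fset_uniq sort_sorted //; apply: leq_total.
Qed.

Lemma match_vars_size m m' : exponents m = exponents m' ->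
  size (sort leq (finsupp m)) = size (sort leq (finsupp m')).
Proof. by move/(congr1 size); rewrite !size_map. Qed.

Lemma match_vars_supp m m' i : exponents m = exponents m' ->
  i \in finsupp m -> match_vars m m' i \in finsupp m'.
Proof.
move=> e im; rewrite -(mem_sort leq) mem_nth // -(match_vars_size e).
by rewrite index_mem mem_sort.
Qed.

Lemma match_varsK m m' i : exponents m = exponents m' ->
  i \in finsupp m -> match_vars m' m (match_vars m m' i) = i.
Proof.
move=> e im; rewrite /match_vars index_uniq ?nth_index ?mem_sort //.
  by rewrite -(match_vars_size e) index_mem mem_sort.
by rewrite sort_uniq fset_uniq.
Qed.

Lemma match_vars_exp m m' i : exponents m = exponents m' ->
  i \in finsupp m -> m' (match_vars m m' i) = m i.
Proof.
move=> e im; have lti : (index i (sort leq (finsupp m)) < size (sort leq (finsupp m)))%N.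
  by rewrite index_mem mem_sort.
have := congr1 (fun s => nth 0%N s (index i (sort leq (finsupp m)))) e.
rewrite !(nth_map 0%N) -?(match_vars_size e) // nth_index ?mem_sort //.
Qed.

Lemma match_vars_mono m m' i j : exponents m = exponents m' ->
  i \in finsupp m -> j \in finsupp m ->
  (match_vars m m' i < match_vars m m' j)%N = (i < j)%N.
Proof.
move=> e; have homo k l : k \in finsupp m -> l \in finsupp m -> (k < l)%N ->
    (match_vars m m' k < match_vars m m' l)%N.
  move=> km lm kl; rewrite -(mem_sort leq (finsupp m) k) in km.
  rewrite -(mem_sort leq (finsupp m) l) in lm.
  apply: (sorted_ltn_nth ltn_trans 0%N (sorted_supp m')).
  - by rewrite inE -(match_vars_size e) index_mem.
  - by rewrite inE -(match_vars_size e) index_mem.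
  rewrite ltnNge leq_eqVlt; apply/negP => /orP[/eqP lk|lk].
    by move: kl; rewrite -(nth_index 0%N km) -lk nth_index // ltnn.
  have := sorted_ltn_index ltn_trans (sorted_supp m) _ _ lm km lk.
  by rewrite ltnNge (ltnW kl).
move=> im jm; apply/idP/idP => [lt|]; last exact: homo.
case: (ltngtP i j) lt => // [ji|->]; last by rewrite ltnn.
by rewrite ltnNge (ltnW (homo _ _ jm im ji)).
Qed.

Lemma relabel_monomial (T : finType) (s : {ffun T -> {fset nat}}) m m' :
  exponents m = exponents m' -> sv_monomial s = m ->
  sv_monomial (relabel (match_vars m m') s) = m'.
Proof.
move=> e sm; apply/eqP/cmP => j; rewrite sv_monomialE.
have sP t i : i \in s t -> i \in finsupp m by rewrite -sm; apply: sv_monomial_supp.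
have [jm'|jm'] := boolP (j \in finsupp m'); last first.
  rewrite (fsfun_dflt jm') big1 // => t _; rewrite ffunE; apply/eqP.
  rewrite eqb0; apply: contra jm' => /imfsetP[i /= /sP im ->].
  exact: match_vars_supp.
have jm := match_vars_supp (esym e) jm'.
rewrite -(match_vars_exp (esym e) jm').
have := match_varsK (esym e) jm'; move: (match_vars m' m j) jm => k km kj.
rewrite -[in RHS]sm sv_monomialE.
apply: eq_bigr => t _; rewrite ffunE; congr nat_of_bool.
apply/imfsetP/idP => [[i /= ist ji]|kt]; last by exists k.
by rewrite -(match_varsK e km) kj ji match_varsK // (sP t).
Qed.

Lemma relabelK (T : finType) (s : {ffun T -> {fset nat}}) m m' :
  exponents m = exponents m' -> sv_monomial s = m ->
  relabel (match_vars m' m) (relabel (match_vars m m') s) = s.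
Proof.
move=> e sm; apply/ffunP => t; rewrite !ffunE.
have sP i : i \in s t -> i \in finsupp m by rewrite -sm; apply: sv_monomial_supp.
apply/fsetP=> j; apply/imfsetP/idP => [[i /= /imfsetP[k /= ks -> ->]]|js].
  by rewrite match_varsK // sP.
by exists (match_vars m m' j); rewrite ?match_varsK ?sP //=; apply/imfsetP; exists j.
Qed.

Lemma sv_gf_qsym b (T : finType) (A : set {ffun T -> {fset nat}}) :
  relabel_closed A -> quasisymmetric (sv_gf b A).
Proof.
move=> Acl m m' e.
have stab m1 m2 (s : {ffun T -> {fset nat}}) : exponents m1 = exponents m2 ->
    A s /\ sv_monomial s = m1 ->
    A (relabel (match_vars m1 m2) s) /\ sv_monomial (relabel (match_vars m1 m2) s) = m2.
  move=> e' [As sm]; split; last exact: relabel_monomial.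
  apply: Acl => // t u i j it ju.
  apply: match_vars_mono => //; rewrite -sm.
    exact: sv_monomial_supp it.
  exact: sv_monomial_supp ju.
rewrite [in RHS]/sv_gf (reindex_fsbig (relabel (match_vars m m')) 
  [set s | A s /\ sv_monomial s = m]); last first.
  split=> [s|s s' /set_mem[_ sm] /set_mem[_ sm'] ss'|s As].
  - exact: stab.
  - by rewrite -(relabelK e sm) ss' (relabelK e sm').
  - exists (relabel (match_vars m' m) s); first exact: stab.
    by apply: relabelK => //; case: As.
apply: eq_fsbigr => s /set_mem[_ sm]; congr (_ ^+ (_ - _)).
apply: eq_bigr => t _; rewrite ffunE card_in_imfset //= => i j /= it jt.
have sP k : k \in s t -> k \in finsupp m by rewrite -sm; apply: sv_monomial_supp.
by move=> /(congr1 (match_vars m' m)); rewrite !match_varsK // sP.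
Qed.

Lemma relabel_set_lt (S T : {fset nat}) (h : nat -> nat) :
  (forall i j, i \in S -> j \in T -> (h i < h j)%N = (i < j)%N) ->
  set_lt S T -> set_lt [fset h i | i in S]%fset [fset h i | i in T]%fset.
Proof.
move=> hmono ST _ _ /imfsetP[i /= iS ->] /imfsetP[j /= jT ->].
by rewrite hmono // ST.
Qed.

Lemma relabel_set_le (S T : {fset nat}) (h : nat -> nat) :
  (forall i j, i \in T -> j \in S -> (h i < h j)%N = (i < j)%N) ->
  set_le S T -> set_le [fset h i | i in S]%fset [fset h i | i in T]%fset.
Proof.
move=> hmono ST _ _ /imfsetP[i /= iS ->] /imfsetP[j /= jT ->].
by rewrite leqNgt hmono // -leqNgt ST.
Qed.

Lemma relabel_neq0 (S : {fset nat}) (h : nat -> nat) :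
  S != fset0 -> [fset h i | i in S]%fset != fset0.
Proof.
by case/fset0Pn => i iS; apply/fset0Pn; exists (h i); apply/imfsetP; exists i.
Qed.

Lemma comp_tuples_relabel (a : composition) : relabel_closed (comp_tuples a).
Proof.
move=> h s hs [s0 sA]; split=> [i|i j ij]; rewrite !ffunE; first exact: relabel_neq0.
have [le lt] := sA i j ij; split=> [|/lt {}lt].
- by apply: relabel_set_le => // k l; apply: hs.
- by apply: relabel_set_lt => // k l; apply: hs.
Qed.

Lemma sv_partitions_relabel (d : Order.disp_t) (P : finPOrderType d)
  (gamma : P -> int) : relabel_closed (sv_partitions gamma).
Proof.
move=> h s hs [s0 sA]; split=> [i|i j ij]; rewrite !ffunE; first exact: relabel_neq0.
have [le lt] := sA i j ij; split=> [|/lt {}lt].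
- by apply: relabel_set_le => // k l; apply: hs.
- by apply: relabel_set_lt => // k l; apply: hs.
Qed.

Fact multifundamental_qsym (b : Zbeta) (a : composition) :
  sv_gf b (comp_tuples a) \in qsym_pred.
Proof. exact/asboolP/sv_gf_qsym/comp_tuples_relabel. Qed.

Fact sv_partitions_qsym (b : Zbeta) (d : Order.disp_t) (P : finPOrderType d)
  (gamma : P -> int) : sv_gf b (sv_partitions gamma) \in qsym_pred.
Proof. exact/asboolP/sv_gf_qsym/sv_partitions_relabel. Qed.

(* L^(b)_a for an arbitrary parameter b in Z[beta]; b = beta and b = 0 are used. *)
Definition multifundamental (b : Zbeta) (a : composition) : mQSym :=
  MQSym (multifundamental_qsym b a).

Definition fundamental (a : composition) : mQSym := multifundamental 0 a.

Definition Gamma (b : Zbeta) (d : Order.disp_t) (P : finPOrderType d)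
    (gamma : P -> int) : mQSym :=
  MQSym (sv_partitions_qsym b gamma).

(* Possibly infinite linear combinations, computed coefficientwise. *)

Fact mQSym_sum_qsym (c : composition -> Zbeta) (F : composition -> mQSym) :
  (fun m => \sum_(a \in [set: composition]) c a * (F a : fps) m) \in qsym_pred.
Proof.
apply/asboolP => m m' e; apply: eq_fsbigr => a _; congr (_ * _).
by have /asboolP := mQSymP (F a); apply.
Qed.

Definition mQSym_sum (c : composition -> Zbeta) (F : composition -> mQSym) : mQSym :=
  MQSym (mQSym_sum_qsym c F).

(* w is the continuous linear map with w(L_a) = L_{phi a}. *)
Definition continuous_extension (phi : composition -> composition)
    (w : {linear mQSym -> mQSym}) : Prop :=
  (forall a, w (fundamental a) = fundamental (phi a)) /\
  (forall c, w (mQSym_sum c fundamental) =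
             mQSym_sum c (fun a => w (fundamental a))).

(* Main.v *)
Require Import Defs.
From mathcomp Require Import all_boot all_order all_algebra.
From mathcomp Require Import finmap.
From mathcomp Require Import boolp classical_sets functions.
From mathcomp Require Import fsbigop.
From mathcomp Require Import monalg.

Set Implicit Arguments.
Unset Strict Implicit.
Unset Printing Implicit Defensive.

Import Order.TTheory GRing.Theory Num.Theory.

Local Open Scope ring_scope.

(** Reading the cells (i, t) with i in sigma(t) in increasing order of (i, gamma t)
    turns a set-valued (P, gamma)-partition into a word W over P that contains every
    letter and respects P, together with a monomial that increases strictly at each
    weak descent of W.  Hence Gamma is the sum over such words W of
    beta^(|W| - |P|) L_(wDes W), where wDes W = { j | gamma W_j >= gamma W_(j+1) }.
    Reversing the word reverses wDes, dualises P and negates gamma, which gives rho.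
    The complement of wDes is the set of strict descents for - gamma; the same count
    with strict descents enumerates multiset-valued partitions, and collapsing the
    repetitions in a multiset shows that these arise from set-valued ones by
    x -> x / (1 - beta x) = x + beta x^2 + ..., which gives psi.  The map omega
    combines both.  L_alpha is the case of a chain labelled with descent set I(alpha). *)

(** * Words and monomials *)

Definition words (T : finType) (n : nat) : seq (seq T) :=
  [seq val W | W : n.-tuple T].

Lemma mem_words (T : finType) n (W : seq T) : (W \in words T n) = (size W == n).
Proof.
apply/mapP/eqP => [[t _ ->]|sW]; first by rewrite size_tuple.
by exists (Tuple (introT eqP sW)); rewrite ?mem_enum.
Qed.

Lemma uniq_words (T : finType) n : uniq (words T n).
Proof. by rewrite map_inj_uniq ?enum_uniq //; apply: val_inj. Qed.

Definition seq_mon (u : seq nat) : monomial := \big[mmul/mone]_(i <- u) ucm i.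

Lemma seq_mon_cons i u : seq_mon (i :: u) = mmul (ucm i) (seq_mon u).
Proof. by rewrite /seq_mon big_cons. Qed.

Lemma seq_monE u i : seq_mon u i = count_mem i u.
Proof.
elim: u => [|j u IHu]; first by rewrite /seq_mon big_nil cm1.
by rewrite seq_mon_cons cmM cmU IHu.
Qed.

Lemma mdeg_seq_mon u : mdeg (seq_mon u) = size u.
Proof.
elim: u => [|j u IHu]; first by rewrite /seq_mon big_nil mdeg1.
by rewrite seq_mon_cons mdegM mdegU IHu.
Qed.

(** Monomials are identified with weakly increasing words of indices, so that pairing [mon_seq m]
    with a word over [T] yields a list of cells. *)
Definition mon_seq (m : monomial) : seq nat :=
  sort leq (flatten [seq nseq (m i) i | i <- finsupp m]).

Lemma mon_seqK m : seq_mon (mon_seq m) = m.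
Proof.
apply/eqP/cmP=> i; rewrite seq_monE /mon_seq.
rewrite (permP (permEl (perm_sort _ _))) count_flatten -map_comp sumnE big_map /=.
under eq_bigr do rewrite count_nseq /=.
have [im|im] := boolP (i \in finsupp m).
  rewrite (big_fsetD1 i) //= eqxx mul1n big1_seq ?addn0 // => j.
  by rewrite in_fsetD1 => /andP[_ /andP[/negPf-> _]].
rewrite big1_seq => [|j /andP[_ jm]]; last first.
  by case: eqP => // ji; rewrite -ji jm in im.
by rewrite (fsfun_dflt im).
Qed.

Lemma mon_seq_sorted m : sorted leq (mon_seq m).
Proof. by rewrite sort_sorted //; apply: leq_total. Qed.

Lemma size_mon_seq m : size (mon_seq m) = mdeg m.
Proof. by rewrite -{2}(mon_seqK m) mdeg_seq_mon. Qed.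

Lemma seq_monK u : sorted leq u -> mon_seq (seq_mon u) = u.
Proof.
move=> us; apply: (sorted_eq leq_trans anti_leq) => //; first exact: mon_seq_sorted.
by apply/allP=> i _ /=; rewrite -!seq_monE mon_seqK.
Qed.

(** * Repeating letters in place *)

Section Stutters.

Variables (X : eqType) (le : rel X).
Hypotheses (le_refl : reflexive le) (le_anti : antisymmetric le)
  (le_trans : transitive le).

(* The words of length n obtained by repeating letters of z in place, each
   letter occurring at least once. *)
Fixpoint stutters (n : nat) (z : seq X) : seq (seq X) :=
  match n, z with
  | 0, [::] => [:: [::]]
  | n'.+1, p :: z' => [seq p :: y | y <- stutters n' z' ++ stutters n' z]
  | _, _ => [::]
  end.

Lemma stutters_small n z : (n < size z)%N -> stutters n z = [::].
Proof.
elim: n z => [|n IHn] [|p z] //= lnz.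
by rewrite !IHn //= ltnW.
Qed.

(** In a list sorted for an antisymmetric order equal letters are adjacent, so [undup y = z] means
    that [y] repeats letters of [z] in place. The induction removes the first letter and asks
    whether it occurs again, which is the branching in [stutters]. *)
Lemma mem_stutters n z y : sorted le z -> uniq z ->
  (y \in stutters n z) = [&& size y == n, sorted le y & undup y == z].
Proof.
elim: n z y => [|n IHn] [|p z] y sz uz.
- by case: y.
- by rewrite /= in_nil; case: y.
- rewrite /= in_nil; apply/esym/negbTE/negP => /and3P[+ _ /eqP uy].
  by rewrite (undup_nil uy).
have minE x s : path le x s = all (le x) s && sorted le s by exact: path_sortedE.
move: sz uz; rewrite /= minE => /andP[pz sz] /andP[zp uz].
have mem_cons q y' : (q :: y' \in [seq p :: y | y <- stutters n z ++ stutters n (p :: z)])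
    = (q == p) && (y' \in stutters n z ++ stutters n (p :: z)).
  apply/mapP/andP => [[x xs [-> ->]]|[/eqP-> ys]]; [by rewrite eqxx|by exists y'].
case: y => [|q y]; first by apply/mapP=> -[].
rewrite mem_cons mem_cat !IHn //=; last 2 first.
- by rewrite minE pz.
- by rewrite zp.
rewrite minE eqSS; case: (size y == n); rewrite ?andbF //=.
have allP' y' : all (le p) (undup y') = all (le p) y' by apply: all_undup.
apply/andP/andP => [[/eqP-> /orP[]/andP[sy /eqP uy]]|[/andP[qy sy]]].
- rewrite sy andbT -allP' uy pz; split=> //.
  by rewrite -uy mem_undup in zp; rewrite (negPf zp).
- rewrite sy andbT -allP' uy /= le_refl pz; split=> //.
  by rewrite -(mem_undup y) uy inE eqxx.
case: ifP => qy' /eqP uy; last by case: uy => -> <-; rewrite eqxx sy eqxx.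
(* Since [p] occurs in [y], [q] is below [p]; conversely [p] is below every letter of [undup y],
   hence of [y], and [q] is one of them. *)
have <- : p = q.
  apply: le_anti; rewrite (allP qy) ?andbT; last by rewrite -(mem_undup y) uy inE eqxx.
  have : all (le p) (undup y) by rewrite uy /= le_refl.
  by move/allP; apply; rewrite mem_undup.
by rewrite eqxx sy uy eqxx orbT.
Qed.

Lemma uniq_stutters n z : sorted le z -> uniq z -> uniq (stutters n z).
Proof.
elim: n z => [|n IHn] [|p z] //= sz /andP[zp uz].
have sz' := path_sorted sz.
rewrite map_inj_uniq => [|? ? [] //]; rewrite cat_uniq !IHn //= ?zp // andbT.
(* A word common to both branches would have [undup] equal to both [z] and [p :: z]. *)
apply/hasPn => y; rewrite !mem_stutters //= ?zp // => /and3P[_ _ /eqP->].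
by rewrite !negb_and (_ : p :: z != z) ?orbT //; apply/eqP=> /(congr1 size) /= /eqP;
  rewrite -[X in _ == X]addn0 -addn1 eqn_add2l.
Qed.

End Stutters.

(** * Substitution of geometric series *)

Lemma sum_nat_bool (X : Type) (s : seq X) (a : pred X) :
  (\sum_(x <- s) a x)%N = count a s.
Proof. by rewrite -sum1_count [RHS]big_mkcond; apply: eq_bigr => x _; case: (a x). Qed.

Lemma pairwise_in (X : eqType) (R : rel X) (s : seq X) p q :
  pairwise R s -> p \in s -> q \in s -> [\/ p = q, R p q | R q p].
Proof.
elim: s => //= x s IHs /andP[/allP xs /IHs{}IHs]; rewrite !inE.
case/predU1P=> [->|ps] /predU1P[->|qs]; [exact: Or31 | | | exact: IHs].
  by apply: Or32; apply: xs.
by apply: Or33; apply: xs.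
Qed.

Lemma mdeg_sv_monomial (T : finType) (s : {ffun T -> {fset nat}}) :
  mdeg (sv_monomial s) = sv_size s.
Proof.
rewrite /sv_monomial mdeg_prod; apply: eq_bigr => t _.
by rewrite /set_monomial mdeg_prod; under eq_bigr do rewrite mdegU; rewrite sum1_size.
Qed.

(** Only the finitely many values of [g] on [s] contribute to the outer sum, so its support is
    finite and the two sums can be exchanged. *)
Lemma fsbig_fibers (R : nmodType) (A : choiceType) (X : eqType)
    (s : seq X) (g : X -> A) (F : X -> R) :
  \sum_(a \in [set: A]) \sum_(x <- s) F x *+ (g x == a) = \sum_(x <- s) F x.
Proof.
rewrite (@fsbigTE _ _ _ _ [fset a in map g s]%fset) => [|a].
  rewrite exchange_big big_seq [RHS]big_seq; apply: eq_bigr => x xs.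
  rewrite (big_fsetD1 (g x)) /=; last by rewrite inE map_f.
  rewrite eqxx big1_seq ?addr0 // => a.
  by rewrite in_fsetD1 eq_sym => /andP[_ /andP[/negPf->]].
rewrite inE => /mapP ag; rewrite big_seq big1 // => x xs.
by case: eqP => // gx; case: ag; exists x.
Qed.

(** The series y = x_i / (1 - beta x_i) satisfies y = x_i + beta x_i y. The two terms correspond to
    the two branches of [stutters]: the run of copies ends, or it continues with one more factor
    beta. *)
Lemma geom_varM i f m : (geom_var i * f) m =
  if (0 < m i)%N then
    f (divcm m (ucm i)) + beta * (geom_var i * f) (divcm m (ucm i)) else 0.
Proof.
have e : geom_var i * f = fps_var i * f + beta *: (fps_var i * (geom_var i * f)).
  rewrite -[in X in X + _]geom_varE mulrBr mulr1 mulrBl -scalerAr -scalerAl.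
  by rewrite [geom_var i * fps_var i]mulrC -mulrA subrK.
rewrite {1}e -[LHS]/((fps_var i * f) m + beta * (fps_var i * (geom_var i * f)) m).
by rewrite !fps_varM; case: ifP => // _; rewrite mulr0 addr0.
Qed.

Lemma divcm_ucmK (i : nat) (m : monomial) :
  (0 < m i)%N -> mmul (ucm i) (divcm m (ucm i)) = m.
Proof.
move=> mi; apply/eqP/cmP=> j; rewrite cmM divcmE subnKC // cmU.
by case: eqP => // <-.
Qed.

Lemma eq_ucm_mmul (i : nat) (k m : monomial) :
  (mmul (ucm i) k == m) = (0 < m i)%N && (k == divcm m (ucm i)).
Proof.
apply/eqP/andP => [<-|[mi /eqP->]]; last exact: divcm_ucmK.
rewrite cmM cmUU; split=> //.
by apply/eqP/esym/eqP/cmP=> j; rewrite divcmE cmM addKn.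
Qed.

(* Expanding each x_i / (1 - beta x_i) as a geometric series replaces every letter of z by
   a run of copies of it. *)
Lemma prod_geom_var (T : eqType) (z : seq (nat * T)) m :
  (\prod_(i <- unzip1 z) geom_var i) m =
  beta ^+ (mdeg m - size z) *+
    count (fun y => seq_mon (unzip1 y) == m) (stutters (mdeg m) z).
Proof.
move: {2}(mdeg m) (erefl (mdeg m)) => n; elim: n z m => [|n IHn] [|[i t] z] m md /=.
- have -> : m = mone by apply/eqP; rewrite -mdeg_eq0 md.
  rewrite [X in X mone = _]big_nil mdeg1 /= /seq_mon big_nil eqxx.
  by rewrite -[LHS]/((mone == mone)%:R) eqxx.
- rewrite [X in X m = _]big_cons geom_varM; case: ifP => [mi|_]; last by rewrite md.
  by move: md; rewrite -(divcm_ucmK mi) mdegM mdegU.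
- by rewrite [X in X m = _]big_nil md -[LHS]/((m == mone)%:R) -mdeg_eq0 md.
rewrite [X in X m = _]big_cons geom_varM md /= count_map.
rewrite (eq_count (a2 := fun y => (0 < m i)%N &&
    (seq_mon (unzip1 y) == divcm m (ucm i)))); last first.
  by move=> y /=; rewrite seq_mon_cons eq_ucm_mmul.
case: ifPn => mi; last by rewrite count_pred0.
have md' : mdeg (divcm m (ucm i)) = n.
  by move: md; rewrite -{1}(divcm_ucmK mi) mdegM mdegU add1n => -[].
have := IHn ((i, t) :: z) _ md'; rewrite /= big_cons => ->; rewrite IHn // md'.
rewrite count_cat mulrnDr subSS; congr (_ + _).
(* Truncated subtraction could spoil the exponent only when [n] is too small for any stutter to
   exist; then the term is zero. *)
have [lt|le] := ltnP n (size ((i, t) :: z)); first by rewrite stutters_small // mulr0.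
by rewrite mulrnAr -exprS subnSK.
Qed.

(** * Set-valued fillings as sorted words of pairs *)

Section Labelled.

Variables (T : finType) (e : rel T) (gamma : T -> int).

Definition lex_le : rel (nat * T) := fun p q =>
  (p.1 < q.1)%N || ((p.1 == q.1) && (gamma p.2 <= gamma q.2)).

Definition lex_lt : rel (nat * T) := fun p q =>
  (p.1 < q.1)%N || ((p.1 == q.1) && (gamma p.2 < gamma q.2)).

Lemma lex_le_refl : reflexive lex_le.
Proof. by move=> p; rewrite /lex_le eqxx lexx orbT. Qed.

Lemma lex_le_trans : transitive lex_le.
Proof.
move=> q p r /orP[pq|/andP[/eqP pq gpq]] /orP[qr|/andP[/eqP qr gqr]].
- by rewrite /lex_le (ltn_trans pq qr).
- by rewrite /lex_le -qr pq.
- by rewrite /lex_le pq qr.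
- by rewrite /lex_le pq qr eqxx (le_trans gpq gqr) orbT.
Qed.

Lemma lex_le_total : total lex_le.
Proof. by move=> p q; rewrite /lex_le; case: ltngtP => //= _; apply: le_total. Qed.

Lemma lex_le_fst s : sorted lex_le s -> sorted leq (unzip1 s).
Proof.
rewrite sorted_map; apply: sub_sorted => p q.
by case/orP=> [/ltnW|/andP[/eqP pq _]] //=; rewrite pq.
Qed.

(** A linear extension with repetitions: if [e t u], every occurrence of [t] comes before every
    occurrence of [u]. *)
Definition extension_word (W : seq T) : bool :=
  [forall t, t \in W] && pairwise (fun t u => ~~ e u t) W.

(** A sorted list of cells with monomial [m] has first components [mon_seq m], so running over the
    words of length [mdeg m] gives a finite enumeration. *)
Definition extension_pairs (R : rel (nat * T)) (m : monomial) : seq (seq (nat * T)) :=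
  [seq z <- [seq zip (mon_seq m) W | W <- words T (mdeg m)] |
    sorted R z && extension_word (unzip2 z)].

Lemma size_extension_pairs R m : size (extension_pairs R m) =
  count (fun W => extension_word W && sorted R (zip (mon_seq m) W))
    (words T (mdeg m)).
Proof.
rewrite size_filter count_map; apply: eq_in_count => W; rewrite mem_words => /eqP sW /=.
by rewrite unzip2_zip ?size_mon_seq ?sW // andbC.
Qed.

Lemma uniq_extension_pairs R m : uniq (extension_pairs R m).
Proof.
rewrite filter_uniq // map_inj_in_uniq ?uniq_words // => V W.
rewrite !mem_words => /eqP sV /eqP sW /(congr1 unzip2).
by rewrite !unzip2_zip ?size_mon_seq ?sV ?sW.
Qed.

Lemma mem_extension_pairs (R : rel (nat * T)) m z : subrel R lex_le ->
  (z \in extension_pairs R m) =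
  [&& sorted R z, extension_word (unzip2 z) & seq_mon (unzip1 z) == m].
Proof.
move=> Rle; rewrite mem_filter -andbA.
case: (boolP (sorted R z)) => //= /(sub_sorted Rle)/lex_le_fst zs.
case: (extension_word _) => //=; apply/mapP/eqP => [[W]|<-].
  rewrite mem_words => /eqP sW ->.
  by rewrite unzip1_zip ?mon_seqK ?size_mon_seq ?sW.
exists (unzip2 z); first by rewrite mem_words mdeg_seq_mon !size_map.
by rewrite seq_monK // zip_unzip.
Qed.

Lemma extension_word_size W : extension_word W -> (#|T| <= size W)%N.
Proof.
case/andP=> /forallP allW _; rewrite cardT; apply: uniq_leq_size => [|t _].
  exact: enum_uniq.
exact: allW.
Qed.

Lemma lex_ltW : subrel lex_lt lex_le.
Proof.
by move=> p q /orP[|/andP[e1 /ltW]]; rewrite /lex_lt /lex_le => ->; rewrite ?e1 ?orbT.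
Qed.

Hypothesis gamma_inj : injective gamma.

Lemma lex_le_anti : antisymmetric lex_le.
Proof.
move=> [i t] [j u]; rewrite /lex_le /=; case: (ltngtP i j) => //= -> /le_anti.
by move/gamma_inj=> ->.
Qed.

Lemma lex_lt_neqAle p q : lex_lt p q = (p != q) && lex_le p q.
Proof.
case: p q => [i t] [j u]; rewrite /lex_lt /lex_le xpair_eqE /=.
case: ltngtP => //= _; rewrite lt_neqAle; congr (~~ _ && _).
by apply/eqP/eqP => [/gamma_inj|->].
Qed.

Lemma sorted_lex_lt z : sorted lex_lt z = uniq z && sorted lex_le z.
Proof.
rewrite (sorted_pairwise lex_le_trans) uniq_pairwise -pairwise_relI.
rewrite sorted_pairwise; last first.
  move=> q p r; rewrite !lex_lt_neqAle => /andP[npq pq] /andP[nqr qr].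
  rewrite (lex_le_trans pq qr) andbT; apply: contraNneq npq => pr; subst r.
  by apply/eqP/lex_le_anti; rewrite pq qr.
by apply: eq_pairwise => p q; rewrite lex_lt_neqAle.
Qed.

Hypothesis e_irr : irreflexive e.

Definition sv_labelled : set {ffun T -> {fset nat}} :=
  [set s | (forall t, s t != fset0) /\
     forall t u : T, e t u ->
       set_le (s t) (s u) /\ (gamma u < gamma t -> set_lt (s t) (s u))]%classic.

Definition pairs_fun (z : seq (nat * T)) : {ffun T -> {fset nat}} :=
  [ffun t => [fset i in [seq p.1 | p <- z & p.2 == t]]%fset].

Lemma in_pairs_fun z t i : (i \in pairs_fun z t) = ((i, t) \in z).
Proof.
rewrite ffunE in_fset; apply/mapP/idP => [[[j u]]|pz].
  by rewrite mem_filter => /andP[/= /eqP -> jz] ->.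
by exists (i, t); rewrite // mem_filter eqxx.
Qed.

Lemma pairs_fun_mon z : uniq z -> sv_monomial (pairs_fun z) = seq_mon (unzip1 z).
Proof.
move=> uz; apply/eqP/cmP=> i; rewrite sv_monomialE seq_monE.
under eq_bigr do rewrite in_pairs_fun -count_uniq_mem // -sum1_count big_mkcond.
rewrite exchange_big /= -sum1_count big_map /= [RHS]big_mkcond.
apply: eq_bigr => -[j u] _ /=; rewrite -big_mkcond sum1_card; case: eqP => [->|/eqP ji].
  by rewrite (eq_card (B := pred1 u)) ?card1 // => t; rewrite !inE -[LHS]/(u == t) eq_sym.
by rewrite eq_card0 // => t; rewrite inE /= xpair_eqE (negPf ji).
Qed.

Lemma pairs_fun_size z : uniq z -> sv_size (pairs_fun z) = size z.
Proof.
by move=> uz; rewrite -mdeg_sv_monomial pairs_fun_mon // mdeg_seq_mon size_map.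
Qed.

(** If [e t u], the cells of [t] precede those of [u] in [z], so they are smaller for [lex_lt]: the
    entries weakly increase, and a tie forces [gamma t < gamma u]. *)
Lemma pairs_fun_labelled z : sorted lex_lt z -> extension_word (unzip2 z) ->
  sv_labelled (pairs_fun z).
Proof.
move=> sz /andP[/forallP allz]; rewrite pairwise_map => pz; split=> [t|t u etu].
  have /mapP[[i t'] iz /= et] := allz t.
  by apply/fset0Pn; exists i; rewrite in_pairs_fun et.
suff H i j : i \in pairs_fun z t -> j \in pairs_fun z u -> lex_lt (i, t) (j, u).
  split=> [i j it ju|gut i j it ju].
    by case/orP: (H i j it ju) => [/ltnW|/andP[/eqP /= ->]].
  case/orP: (H i j it ju) => [|/andP[_ /=]] //.
  by move/lt_trans/(_ gut); rewrite ltxx.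
rewrite !in_pairs_fun => itz juz.
move: sz; rewrite sorted_lex_lt (sorted_pairwise lex_le_trans) => /andP[uz lz].
rewrite lex_lt_neqAle; have -> /= : (i, t) != (j, u).
  by apply: contraTneq etu => -[_ ->]; rewrite e_irr.
have {}pz : pairwise [rel p q | lex_le p q && ~~ e q.2 p.2] z.
  by rewrite pairwise_relI lz.
case: (pairwise_in pz itz juz) => [[_ tu]|/andP[] //|/andP[_ /=]]; last by rewrite etu.
by move: etu; rewrite tu e_irr.
Qed.

(** The list is obtained by sorting all cells of [s]. If [e u t] and a cell of [t] came before a
    cell of [u], the weak inequality between [s u] and [s t] would force a tie, and the tie
    [gamma t < gamma u], which contradicts strictness. *)
Lemma labelled_pairs_fun s : sv_labelled s ->
  exists2 z, sorted lex_lt z && extension_word (unzip2 z) & pairs_fun z = s.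
Proof.
move=> [s0 se].
pose z := sort lex_le [seq (i, t) | t <- enum T, i <- enum_fset (s t)].
have mz i t : ((i, t) \in z) = (i \in s t).
  rewrite mem_sort; apply/allpairsPdep/idP => [[t' [i' [_ + [-> ->]]]] //|its].
  by exists t, i; rewrite mem_enum.
have uz : uniq z.
  rewrite sort_uniq; apply: allpairs_uniq_dep => [|t _|]; rewrite ?enum_uniq //.
  by move=> [t i] [t' i'] _ _ [-> ->].
have sz : sorted lex_lt z.
  by rewrite sorted_lex_lt uz sort_sorted //; apply: lex_le_total.
exists z; last by apply/ffunP=> t; apply/fsetP=> i; rewrite in_pairs_fun mz.
rewrite sz /=; apply/andP; split.
  apply/forallP=> t; have /fset0Pn[i it] := s0 t; apply/mapP; exists (i, t) => //.
  by rewrite mz.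
rewrite pairwise_map.
move: sz; rewrite sorted_lex_lt (sorted_pairwise lex_le_trans) => /andP[_].
have : all [in z] z by apply/allP.
rewrite uniq_pairwise in uz => az lz.
have {lz uz} : pairwise lex_lt z.
  apply: (sub_pairwise (r := [rel p q | (p != q) && lex_le p q])).
    by move=> p q; rewrite lex_lt_neqAle.
  by rewrite pairwise_relI uz.
apply: sub_in_pairwise az => -[i t] [j u]; rewrite !mz /= => it ju lt.
apply/negP=> eut; have [le lt'] := se _ _ eut.
case/orP: lt => /= [ij|/andP[/eqP ij gtu]].
  by have := le _ _ ju it; rewrite leqNgt ij.
by have := lt' gtu _ _ ju it; rewrite ij ltnn.
Qed.

(** [pairs_fun] is a bijection from strictly sorted extension lists onto fillings, and every filling
    with monomial [m] has size [mdeg m], so all terms carry the same power of [b]. *)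
Lemma sv_gf_labelled b m : sv_gf b sv_labelled m =
  b ^+ (mdeg m - #|T|) *+ size (extension_pairs lex_lt m).
Proof.
have memz z : z \in extension_pairs lex_lt m ->
    [/\ sorted lex_lt z, extension_word (unzip2 z), seq_mon (unzip1 z) = m & uniq z].
  rewrite (mem_extension_pairs _ _ lex_ltW) => /and3P[sz ez /eqP mz]; split=> //.
  by move: sz; rewrite sorted_lex_lt => /andP[].
rewrite /sv_gf (@reindex_fsbig _ _ _ _ _ pairs_fun
  [set` extension_pairs lex_lt m]%classic); last first.
  split=> [z /memz[sz ez mz uz]|z z'|s [As ms]].
  - by split; [exact: pairs_fun_labelled | rewrite pairs_fun_mon].
  - rewrite !in_setE => /memz[sz _ _ _] /memz[sz' _ _ _] zz'.
    move: sz sz'; rewrite !sorted_lex_lt => /andP[uz sz] /andP[uz' sz'].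
    apply: (sorted_eq lex_le_trans lex_le_anti) => //; apply: uniq_perm => // -[i t].
    by rewrite -!in_pairs_fun zz'.
  have [z /andP[sz ez] zs] := labelled_pairs_fun As; exists z => //=.
  have uz : uniq z by move: sz; rewrite sorted_lex_lt => /andP[].
  by rewrite (mem_extension_pairs _ _ lex_ltW) sz ez -ms -zs pairs_fun_mon // eqxx.
rewrite -fsbig_seq ?uniq_extension_pairs // big_seq.
rewrite (eq_bigr (fun=> b ^+ (mdeg m - #|T|))) => [|z /memz[_ _ mz uz]].
  by rewrite -big_seq big_const_seq count_predT iter_addr_0.
by rewrite pairs_fun_size // -mz mdeg_seq_mon size_map.
Qed.

End Labelled.

(** * Geometric substitution in the generating function of a labelled relation *)

Section Substitution.

Variables (T : finType) (e : rel T) (gamma : T -> int).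
Hypotheses (gamma_inj : injective gamma) (e_irr : irreflexive e).

Local Notation le := (lex_le gamma).
Local Notation lt := (lex_lt gamma).
Local Notation le_trans := (@lex_le_trans _ gamma).

(** In a sorted list equal cells are adjacent, so deleting copies preserves the relative order of
    distinct cells; copies of one cell are harmless because [e] is irreflexive. *)
Lemma extension_word_undup y : sorted le y ->
  extension_word e (unzip2 (undup y)) = extension_word e (unzip2 y).
Proof.
move=> sy; congr (_ && _).
  apply: eq_forallb => t; apply/mapP/mapP => -[p py ->]; exists p => //.
    by rewrite -mem_undup.
  by rewrite mem_undup.
rewrite !pairwise_map; apply/idP/idP => [py|].
  have sy' := undup_sorted le_trans sy.
  rewrite (sorted_pairwise le_trans) in sy; rewrite (sorted_pairwise le_trans) in sy'.
  have {}py : pairwise [rel p q | le p q && ~~ e q.2 p.2] (undup y).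
    by rewrite pairwise_relI sy'.
  have ay : all [in y] y by apply/allP.
  apply: sub_in_pairwise ay sy => p q; rewrite /in_mem /= => yp yq le_pq /=.
  rewrite -![_ y _]mem_undup in yp yq.
  case: (pairwise_in py yp yq) => [->|/andP[] //|/andP[/= le_qp _]].
    by rewrite e_irr.
  have -> : p = q by apply: (lex_le_anti gamma_inj); rewrite le_pq le_qp.
  by rewrite e_irr.
exact/subseq_pairwise/undup_subseq.
Qed.

(** Both sides count the weakly sorted lists with monomial [m] whose distinct cells form [z]. *)
Lemma count_stutters m z : sorted lt z -> extension_word e (unzip2 z) ->
  count (fun y => seq_mon (unzip1 y) == m) (stutters (mdeg m) z) =
  count (fun y => undup y == z) (extension_pairs e le m).
Proof.
rewrite (sorted_lex_lt gamma_inj) => /andP[uz sz] ez.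
rewrite -!size_filter; apply/perm_size/uniq_perm.
- apply: filter_uniq; apply: (@uniq_stutters _ le) => //.
  - exact: lex_le_refl.
  - exact: lex_le_anti.
  - exact: le_trans.
- exact/filter_uniq/uniq_extension_pairs.
move=> y; rewrite mem_filter [RHS]mem_filter.
rewrite (@mem_extension_pairs _ e gamma) // (@mem_stutters _ le) //; last first.
- exact: le_trans.
- exact: lex_le_anti.
- exact: lex_le_refl.
case: (boolP (sorted le y)) => sy; last by rewrite !andbF.
rewrite /= -extension_word_undup //.
have [->|_] := eqVneq (undup y) z; last by rewrite !andbF.
rewrite ez andbT; have [<-|] := eqVneq; last by rewrite andbF.
by rewrite mdeg_seq_mon size_map eqxx.
Qed.

Lemma prod_mon_seq (k : monomial) :
  \prod_(i <- finsupp k) geom_var i ^+ k i = \prod_(i <- mon_seq k) geom_var i.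
Proof.
rewrite (perm_big _ (permEl (perm_sort _ _))) big_flatten big_map.
by apply: eq_bigr => i _; rewrite big_nseq iter_mulr_1.
Qed.

(** A weakly sorted list [y] is a strictly sorted list [undup y] together with repetitions. The
    set-valued filling gives the exponent [mdeg k - #|T|], the repetitions give [mdeg m - mdeg k],
    and the sum [mdeg m - #|T|] no longer depends on [k]. *)
Lemma subst_labelled_coef k m :
  sv_gf beta (sv_labelled e gamma) k * (\prod_(i <- finsupp k) geom_var i ^+ k i) m =
  \sum_(y <- extension_pairs e le m)
    beta ^+ (mdeg m - #|T|) *+ (seq_mon (unzip1 (undup y)) == k).
Proof.
have memz z : _ := @mem_extension_pairs _ e gamma _ k z (@lex_ltW _ gamma).
rewrite sv_gf_labelled // prod_mon_seq.
transitivity (\sum_(z <- extension_pairs e lt k) \sum_(y <- extension_pairs e le m)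
    beta ^+ (mdeg m - #|T|) *+ (undup y == z)).
  rewrite mulrnAl -iter_addr_0 -(count_predT (extension_pairs _ _ _)) -big_const_seq.
  rewrite big_seq [RHS]big_seq; apply: eq_bigr => z; rewrite memz => /and3P[sz ez /eqP zk].
  have sz' : sorted leq (unzip1 z) by apply/(@lex_le_fst _ gamma)/(sub_sorted (@lex_ltW _ gamma)).
  have -> : mon_seq k = unzip1 z by rewrite -zk seq_monK.
  rewrite prod_geom_var count_stutters // sumrMnr.
  rewrite sum_nat_bool -count_stutters //.
  (* If [z] is longer than the degree of [m], both sides vanish, so truncated subtraction does no
     harm. *)
  have [small|le_zm] := ltnP (mdeg m) (size z).
    by rewrite stutters_small // !mulr0n mulr0.
  rewrite mulrnAr -exprD -zk mdeg_seq_mon size_map; congr (_ ^+ _ *+ _).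
  by rewrite addnC addnBA ?subnK //; have := extension_word_size ez; rewrite size_map.
rewrite exchange_big big_seq [RHS]big_seq; apply: eq_bigr => y.
rewrite (@mem_extension_pairs _ e gamma) // => /and3P[sy ey _].
rewrite sumrMnr; congr (_ *+ _).
(* For fixed [y] the only possible [z] is [undup y], which belongs to the list for [k] exactly when
   its monomial is [k]. *)
have -> : (seq_mon (unzip1 (undup y)) == k) = (undup y \in extension_pairs e lt k).
  rewrite memz sorted_lex_lt // undup_uniq undup_sorted ?extension_word_undup ?ey //.
  exact: le_trans.
rewrite -count_uniq_mem ?uniq_extension_pairs // -sum_nat_bool.
by apply: eq_bigr => z _; rewrite eq_sym.
Qed.

(** Each [y] contributes only at the monomial [k] of [undup y], so the sum over [k] has finite
    support and collapses to a count of all weakly sorted lists. *)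
Lemma subst_labelled m : fps_subst geom_var (sv_gf beta (sv_labelled e gamma)) m =
  beta ^+ (mdeg m - #|T|) *+ size (extension_pairs e le m).
Proof.
rewrite /fps_subst; under eq_fsbigr do rewrite subst_labelled_coef.
by rewrite fsbig_fibers big_const_seq count_predT iter_addr_0.
Qed.

End Substitution.

(** * Compositions and fundamental quasisymmetric functions *)

Lemma descentsP (a : seq nat) j :
  reflect (exists2 i, (0 < i < size a)%N & j = sumn (take i a)) (j \in descents a).
Proof.
apply: (iffP mapP) => -[i ia ->]; exists i => //; move: ia; rewrite mem_iota;
  by case: (size a) => [|n]; rewrite ?andbF ?add1n //; case: i.
Qed.

Lemma sumn_drop_take (a : seq nat) i : sumn (drop i a) = (sumn a - sumn (take i a))%N.
Proof. by rewrite -{2}(cat_take_drop i a) sumn_cat addKn. Qed.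

Lemma sumn_gt0 (s : seq nat) : all (leq 1) s -> (0 < size s)%N -> (0 < sumn s)%N.
Proof. by case: s => //= x s /andP[x0 _] _; rewrite addn_gt0 x0. Qed.

Lemma descents_bound (a : composition) j : j \in descents a -> (0 < j < sumn a)%N.
Proof.
case/descentsP=> i /andP[i0 ia] ->.
have := parts_gt0 a; rewrite -{1}(cat_take_drop i a) all_cat => /andP[pt pd].
have t0 : (0 < sumn (take i a))%N by apply: sumn_gt0; rewrite // size_take ia.
have d0 : (0 < sumn (drop i a))%N by apply: sumn_gt0; rewrite // size_drop subn_gt0.
by rewrite t0 -[X in (_ < sumn X)%N](cat_take_drop i a) sumn_cat -addn1 leq_add2l.
Qed.

(** Prefix sums of the reversal are suffix sums of [a], that is, [sumn a] minus prefix sums. The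
    converse is the same inclusion for [comp_rev a]. *)
Lemma mem_descents_rev (a : composition) j : (j \in descents (comp_rev a)) =
  (0 < j < sumn a)%N && ((sumn a - j)%N \in descents a).
Proof.
have rev_sub (b : composition) k : k \in descents (comp_rev b) ->
    (sumn b - k)%N \in descents b.
  case/descentsP=> i; rewrite size_rev => /andP[i0 ia] ->.
  rewrite /= take_rev sumn_rev.
  apply/descentsP; exists (size b - i)%N; last first.
    rewrite sumn_drop_take subKn // -[X in (_ <= sumn X)%N](cat_take_drop (size b - i) b).
    by rewrite sumn_cat leq_addr.
  by rewrite subn_gt0 ia -subn_gt0 subKn // ltnW.
apply/idP/andP => [ja|[/andP[j0 ja]] jd].
  have := descents_bound ja; rewrite /= sumn_rev => jb; split=> //.
  exact: rev_sub.
have := rev_sub (comp_rev a) (sumn a - j)%N.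
rewrite /= sumn_rev subKn ?(ltnW ja) //; apply.
by rewrite /= revK.
Qed.

Lemma sumn_comp_rev (a : composition) : sumn (comp_rev a) = sumn a.
Proof. exact: sumn_rev. Qed.

Lemma path_iota_filter n (p : pred nat) :
  path ltn 0%N (rcons [seq i <- iota 1 n | p i] n.+1).
Proof.
have : path ltn 0%N (rcons (iota 1 n) n.+1).
  rewrite (_ : rcons _ _ = iota 1 n.+1); last by rewrite -cats1 -[n.+1]addn1 iotaD add1n addn1.
  by rewrite -[path _ _ _]/(sorted ltn (iota 0 n.+2)) iota_ltn_sorted.
apply: subseq_path; first exact: ltn_trans.
by rewrite -!cats1 cat_subseq ?filter_subseq.
Qed.

Definition comp_at_parts (n : nat) (p : pred nat) : seq nat :=
  comp_of_descents n [seq i <- iota 1 n.-1 | p i].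

Lemma comp_at_gt0 n p : all (leq 1) (comp_at_parts n p).
Proof. by case: n => // n; apply/pairmap_sub_gt0/path_iota_filter. Qed.

Definition comp_at (n : nat) (p : pred nat) : composition := Composition (comp_at_gt0 n p).

Lemma sumn_comp_at n p : sumn (comp_at n p) = n.
Proof.
case: n => // n; rewrite /= /comp_at_parts.
have := sumn_take_pairmap_sub (path_iota_filter n p) (leqnn _); rewrite add0n.
by rewrite take_oversize ?size_pairmap // size_rcons /= nth_rcons ltnn eqxx.
Qed.

Lemma mem_descents_comp_at n p j :
  (j \in descents (comp_at n p)) = (0 < j < n)%N && p j.
Proof.
case: n => [|n]; first by rewrite ltn0 andbF.
have -> : descents (comp_at n.+1 p) = [seq i <- iota 1 n | p i].
  rewrite /descents size_pairmap size_rcons.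
  apply: (@eq_from_nth _ 0%N) => [|k]; rewrite size_map size_iota //= => lk.
  rewrite (nth_map 0%N) ?size_iota // nth_iota // add1n.
  have := @sumn_take_pairmap_sub 0%N _ k.+1 (path_iota_filter n p).
  by rewrite add0n => -> /=; rewrite ?nth_rcons ?lk ?size_rcons // ltnS ltnW.
by rewrite mem_filter mem_iota add1n andbC.
Qed.

(** The condition for [m] to occur in the fundamental function of [a]. A descent [j] compares the
    letters numbered j and j + 1, found at the 0-based positions [j.-1] and [j]. *)
Definition adapted (a : composition) (m : monomial) : bool :=
  (sumn a == mdeg m) &&
  all (fun j => nth 0%N (mon_seq m) j.-1 < nth 0%N (mon_seq m) j)%N (descents a).

Lemma eq_adapted (a b : composition) m :
  sumn a = sumn b -> descents a =i descents b -> adapted a m = adapted b m.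
Proof. by move=> ab dab; rewrite /adapted ab (eq_all_r dab). Qed.

Definition singletons n (u : seq nat) : {ffun 'I_n -> {fset nat}} :=
  [ffun i : 'I_n => [fset nth 0%N u i]%fset].

Lemma sv_monomial_singletons n u : size u = n ->
  sv_monomial (singletons n u) = seq_mon u.
Proof.
move=> su; apply/eqP/cmP=> k; rewrite sv_monomialE seq_monE -sum_nat_bool.
rewrite (big_nth 0%N) big_mkord su; apply: eq_bigr => i _.
by rewrite ffunE in_fset1 eq_sym.
Qed.

Lemma sv_size_eq_card n (s : {ffun 'I_n -> {fset nat}}) :
  (forall i, s i != fset0) -> (sv_size s <= n)%N ->
  exists2 u, size u = n & s = singletons n u.
Proof.
move=> s0 sn.
have c1 : {in 'I_n, forall i, (1 <= #|` s i|)%N} by move=> i _; rewrite cardfs_gt0.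
have : (\sum_(i < n) 1 == sv_size s)%N.
  by rewrite eqn_leq leq_sum ?sum1_card ?card_ord // => i _; rewrite cardfs_gt0.
rewrite /sv_size (leqif_sum (C := fun i => 1%N == #|` s i|)) => [/forallP /= s1|i _]; last first.
  by split; rewrite // cardfs_gt0.
have /choice[f fP] i : exists x, s i = [fset x]%fset.
  by have := s1 i; rewrite eq_sym => /cardfs1P.
exists [seq f i | i <- enum 'I_n]; first by rewrite size_map size_enum_ord.
apply/ffunP=> i; rewrite ffunE (nth_map i) ?size_enum_ord // nth_ord_enum.
exact: fP.
Qed.

(** At parameter 0 only tuples of total size [sumn a] survive. Their sets are nonempty, hence
    singletons, and their entries in order must be [mon_seq m], so at most one tuple remains. *)
Lemma fundamental_coef (a : composition) m : (fundamental a : fps) m = (adapted a m)%:R.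
Proof.
pose s0 := singletons (sumn a) (mon_seq m).
have uniq_s s : comp_tuples a s -> sv_monomial s = m -> (mdeg m <= sumn a)%N ->
    s = s0 /\ adapted a m.
  move=> [sn0 sA] sm; rewrite -[in mdeg m]sm mdeg_sv_monomial.
  move=> /(sv_size_eq_card sn0)[u su su0].
  have um : seq_mon u = m by rewrite -sm su0 sv_monomial_singletons.
  have le_u i : (i.+1 < size u)%N -> (nth 0%N u i <= nth 0%N u i.+1)%N.
    rewrite su => lti.
    have [le _] := sA (Ordinal (ltnW lti)) (Ordinal lti) erefl.
    by apply: le; rewrite su0 ffunE in_fset1.
  have uE : mon_seq m = u by rewrite -um seq_monK //; apply/(sortedP 0%N).
  split; first by rewrite su0 /s0 uE.
  rewrite /adapted -um mdeg_seq_mon um su eqxx uE.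
  apply/allP=> -[|j] jd; have /andP[j0 ja] := descents_bound jd => //.
  have [_ /(_ jd) lt] := sA (Ordinal (ltnW ja)) (Ordinal ja) erefl.
  by apply: lt; rewrite su0 ffunE in_fset1.
rewrite -[LHS]/(sv_gf 0 (comp_tuples a) m) /sv_gf.
case: (boolP (adapted a m)) => [/andP[/eqP am /allP ad]|nad]; last first.
  apply: fsbig1 => s [sA sm]; rewrite card_ord -mdeg_sv_monomial sm.
  (* A larger degree gives a positive power of 0. Otherwise the truncated exponent gives 0^0 = 1,
     but then [uniq_s] would make [m] adapted. *)
  have [le|lt] := leqP (mdeg m) (sumn a).
    by have [_ ad] := uniq_s s sA sm le; rewrite ad in nad.
  by rewrite expr0n subn_eq0 leqNgt lt.
have sz : size (mon_seq m) = sumn a by rewrite size_mon_seq.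
rewrite (_ : [set _ | _]%classic = [set s0]%classic) ?fsbig_set1.
  by rewrite card_ord -mdeg_sv_monomial sv_monomial_singletons // mon_seqK am subnn expr0.
apply/seteqP; split=> [s [sA sm]|_ ->].
  by have [] := uniq_s s sA sm; rewrite ?am.
rewrite /= sv_monomial_singletons // mon_seqK; split=> //; split=> [i|i j ij].
  by rewrite ffunE; apply/fset0Pn; exists (nth 0%N (mon_seq m) i); rewrite in_fset1.
split=> [|jd] k l; rewrite !ffunE !in_fset1 => /eqP-> /eqP->.
  apply: (sorted_leq_nth leq_trans leqnn 0%N (mon_seq_sorted m)); rewrite ?inE ?sz //.
  by rewrite ij.
by have := ad _ jd; rewrite ij.
Qed.

(** * Expansion over words and the three involutions *)

Section WordExpansion.

Variables (T : finType) (e : rel T) (gamma : T -> int).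

Local Notation label W i := (nth 0 [seq gamma t | t <- W] i).

Definition word_comp (W : seq T) : composition :=
  comp_at (size W) (fun j => label W j <= label W j.-1).

(** The entries of consecutive cells weakly increase anyway, so sortedness only demands a strict
    increase where [r] fails on the labels, and these places are the descents of [a]. *)
Lemma adapted_sorted (r : rel int) (a : composition) (m : monomial) (W : seq T) :
    size W = mdeg m -> sumn a = mdeg m ->
    (forall j, (0 < j < size W)%N -> (j \in descents a) = ~~ r (label W j.-1) (label W j)) ->
  adapted a m = sorted [rel p q : nat * T |
    (p.1 < q.1)%N || ((p.1 == q.1) && r (gamma p.2) (gamma q.2))] (zip (mon_seq m) W).
Proof.
(* A letter [t0] serves as default value for [nth] on cells; the empty word is settled apart. *)
move=> sW sa dW; case: (pickP (mem W)) => [t0 _|W0]; last first.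
  have {}W0 : W = [::] by case: (W) W0 => // t V /(_ t); rewrite /= mem_head.
  rewrite /adapted sa eqxx W0; case: (mon_seq m) => [|? ?];
    by apply/allP=> j /descents_bound; rewrite sa -sW W0 ltn0 andbF.
have szip : size (zip (mon_seq m) W) = mdeg m by rewrite size_zip size_mon_seq sW minnn.
rewrite /adapted sa eqxx; apply/allP/(sortedP (0%N, t0)) => [ad i|sz j jd].
  rewrite szip => ilt; rewrite !nth_zip ?size_mon_seq ?sW //=.
  have [/ad /= ->//|] := boolP (i.+1 \in descents a).
  have [iW ltiW] : (i < size W)%N /\ (i.+1 < size W)%N by rewrite sW ilt ltnW.
  rewrite dW ?sW // negbK /= (nth_map t0 _ _ iW) (nth_map t0 _ _ ltiW) => ->.
  rewrite andbT orbC -leq_eqVlt.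
  by apply: (sorted_leq_nth leq_trans leqnn 0%N (mon_seq_sorted m));
    rewrite ?inE ?size_mon_seq // ltnW.
have /andP[] := descents_bound jd; case: j jd => // j jd _; rewrite sa => jlt.
have := sz j; rewrite szip => /(_ jlt); rewrite !nth_zip ?size_mon_seq ?sW //=.
case/orP=> // /andP[_]; move: jd.
have [jW ltjW] : (j < size W)%N /\ (j.+1 < size W)%N by rewrite sW jlt ltnW.
by rewrite dW ?sW //= (nth_map t0 _ _ jW) (nth_map t0 _ _ ltjW) => /negPf->.
Qed.

Lemma adapted_word_comp m W : size W = mdeg m ->
  adapted (word_comp W) m = sorted (lex_lt gamma) (zip (mon_seq m) W).
Proof.
move=> sW; apply: (@adapted_sorted (fun x y => x < y)); rewrite ?sumn_comp_at // => j jb.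
by rewrite mem_descents_comp_at jb -leNgt.
Qed.

(** The complement of the weak descents consists of the strict ascents of the labels, exactly the
    places where the weak order of the negated labels fails. *)
Lemma adapted_word_compl m W : size W = mdeg m ->
  adapted (comp_compl (word_comp W)) m =
  sorted (lex_le (fun t => - gamma t)) (zip (mon_seq m) W).
Proof.
move=> sW; apply: (@adapted_sorted (fun x y => - x <= - y));
  rewrite ?sumn_comp_compl ?sumn_comp_at // => j jb.
by rewrite mem_descents_compl sumn_comp_at mem_descents_comp_at jb lerN2.
Qed.

Hypotheses (gamma_inj : injective gamma) (e_irr : irreflexive e).

(** The coefficient of [fundamental a] in the generating function of [sv_labelled e gamma]. *)
Definition word_coef (a : composition) : Zbeta :=
  beta ^+ (sumn a - #|T|) *+
    count (fun W => extension_word e W && (word_comp W == a)) (words T (sumn a)).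

(** Since [phi] preserves the size, only compositions of size [mdeg m] contribute, and grouping the
    words of that length by [word_comp] gives the sum. *)
Lemma word_coef_sum (phi : composition -> composition) m :
    (forall a, sumn (phi a) = sumn a) ->
  \sum_(a \in [set: composition]%classic) word_coef a * (adapted (phi a) m)%:R =
  beta ^+ (mdeg m - #|T|) *+
    count (fun W => extension_word e W && adapted (phi (word_comp W)) m)
      (words T (mdeg m)).
Proof.
move=> phi_sum.
pose F W : Zbeta := beta ^+ (mdeg m - #|T|) *+
  (extension_word e W && adapted (phi (word_comp W)) m).
transitivity (\sum_(a \in [set: composition]%classic)
    \sum_(W <- words T (mdeg m)) F W *+ (word_comp W == a)).
  apply: eq_fsbigr => a _; rewrite /word_coef; have [am|am] := eqVneq (sumn a) (mdeg m).
    rewrite am mulr_natr -mulrnA -sum_nat_bool big_distrl /=.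
    under [RHS]eq_bigr do rewrite /F -mulrnA.
    rewrite [RHS]sumrMnr; congr (_ *+ _).
    apply: eq_bigr => W _.
    case: eqP => [->|_]; last by rewrite andbF !muln0.
    by rewrite andbT muln1 mulnb.
  rewrite {1}/adapted phi_sum (negPf am) mulr0 big_seq big1 // => W.
  rewrite mem_words => /eqP sW; case: eqP => // Wa.
  by move: am; rewrite -Wa sumn_comp_at sW eqxx.
by rewrite fsbig_fibers sumrMnr sum_nat_bool.
Qed.

Lemma labelled_expansion (F : mQSym) (phi : composition -> composition)
    (w : {linear mQSym -> mQSym}) m :
    (F : fps) = sv_gf beta (sv_labelled e gamma) ->
    (forall a, sumn (phi a) = sumn a) -> continuous_extension phi w ->
  (w F : fps) m = beta ^+ (mdeg m - #|T|) *+
    count (fun W => extension_word e W && adapted (phi (word_comp W)) m)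
      (words T (mdeg m)).
Proof.
move=> FE phi_sum [w_fund w_sum].
(* The case where [phi] is the identity identifies [F]; continuity then lets [w] act term by
   term. *)
have -> : F = mQSym_sum word_coef fundamental.
  apply/val_inj/funext => k; rewrite -[LHS]/((F : fps) k) FE sv_gf_labelled //.
  rewrite -[RHS]/(\sum_(a \in [set: composition]%classic) word_coef a * (fundamental a : fps) k).
  under eq_fsbigr do rewrite fundamental_coef.
  rewrite (@word_coef_sum id) // size_extension_pairs; congr (_ *+ _).
  apply: eq_in_count => W; rewrite mem_words => /eqP sW; congr (_ && _).
  by rewrite adapted_word_comp.
rewrite w_sum -[LHS]/(\sum_(a \in [set: composition]%classic)
  word_coef a * (w (fundamental a) : fps) m).
under eq_fsbigr do rewrite w_fund fundamental_coef.
exact: word_coef_sum.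
Qed.


End WordExpansion.

(** * Reversal of words and its effect on descents *)

Lemma pairwise_rev (X : Type) (r : rel X) s :
  pairwise r (rev s) = pairwise (fun x y => r y x) s.
Proof. by elim: s => //= x s IHs; rewrite rev_cons pairwise_rcons all_rev IHs. Qed.

Lemma extension_word_rev (T : finType) (e : rel T) W :
  extension_word (fun t u => e u t) (rev W) = extension_word e W.
Proof.
rewrite /extension_word pairwise_rev; congr (_ && _).
by apply: eq_forallb => t; rewrite mem_rev.
Qed.

Lemma count_words_rev (T : finType) n (p : pred (seq T)) :
  count (fun W => p (rev W)) (words T n) = count p (words T n).
Proof.
rewrite -[LHS](count_map rev p); apply/permP/uniq_perm.
- by rewrite map_inj_uniq ?uniq_words //; apply: (can_inj revK).
- exact: uniq_words.
move=> W; rewrite mem_words; apply/mapP/eqP => [[V]|sW].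
  by rewrite mem_words => /eqP sV ->; rewrite size_rev.
by exists (rev W); rewrite ?revK // mem_words size_rev sW.
Qed.

(** Reversal moves the pair of neighbours at position j to position n - j and swaps the two;
    negating the labels restores the direction of the inequality. *)
Lemma descents_word_comp_rev (T : finType) (gamma : T -> int) W :
  descents (comp_rev (word_comp gamma W)) =i
  descents (word_comp (fun t => - gamma t) (rev W)).
Proof.
move=> j; rewrite mem_descents_rev sumn_comp_at !mem_descents_comp_at size_rev.
have [/andP[j0 jn]|//] := boolP (0 < j < size W)%N.
rewrite subn_gt0 jn -subn_gt0 subKn ?(ltnW jn) // j0 /=.
rewrite (map_comp (fun x : int => - x) gamma) map_rev.
have jn' : (j.-1 < size W)%N by rewrite (leq_ltn_trans (leq_pred j)).
rewrite !(nth_map 0) ?size_rev ?size_map // lerN2 !nth_rev ?size_map //.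
by rewrite prednK // subnS.
Qed.

(** Complementation commutes with the reflection of j to n - j, so a comparison through reversal
    passes to the transpose. *)
Lemma descents_comp_transpose (a b : composition) :
    sumn a = sumn b -> descents (comp_rev a) =i descents b ->
  descents (comp_transpose a) =i descents (comp_compl b).
Proof.
move=> ab dab j; rewrite mem_descents_rev sumn_comp_compl !mem_descents_compl -ab.
rewrite -dab mem_descents_rev.
case: (boolP (0 < j < sumn a)%N) => //= /andP[j0 jn].
by rewrite subn_gt0 jn -subn_gt0 subKn ?(ltnW jn) // j0.
Qed.

Section Involutions.

Variables (T : finType) (e : rel T) (gamma : T -> int).
Hypotheses (gamma_inj : injective gamma) (e_irr : irreflexive e).

Lemma oppr_label_inj : injective (fun t => - gamma t).
Proof. by move=> t u /oppr_inj/gamma_inj. Qed.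

Variables (F : mQSym) (w : {linear mQSym -> mQSym}).
Hypothesis FE : (F : fps) = sv_gf beta (sv_labelled e gamma).

Lemma compl_labelled : continuous_extension comp_compl w ->
  w F = fps_subst geom_var (sv_gf beta (sv_labelled e (fun t => - gamma t))) :> fps.
Proof.
move=> wP; apply/funext=> m.
rewrite (labelled_expansion gamma_inj e_irr _ FE sumn_comp_compl wP).
rewrite (subst_labelled oppr_label_inj e_irr) size_extension_pairs; congr (_ *+ _).
apply: eq_in_count => W; rewrite mem_words => /eqP sW.
by rewrite adapted_word_compl.
Qed.

Lemma rev_labelled : continuous_extension comp_rev w ->
  w F = sv_gf beta (sv_labelled (fun t u => e u t) (fun t => - gamma t)) :> fps.
Proof.
move=> wP; apply/funext=> m.
rewrite (labelled_expansion gamma_inj e_irr _ FE sumn_comp_rev wP).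
rewrite (sv_gf_labelled oppr_label_inj) // size_extension_pairs; congr (_ *+ _).
rewrite -[RHS]count_words_rev; apply: eq_in_count => W; rewrite mem_words => /eqP sW.
rewrite extension_word_rev; congr (_ && _).
rewrite -adapted_word_comp ?size_rev //; apply: eq_adapted.
  by rewrite sumn_comp_rev !sumn_comp_at size_rev.
exact: descents_word_comp_rev.
Qed.

Lemma transpose_labelled : continuous_extension comp_transpose w ->
  w F = fps_subst geom_var (sv_gf beta (sv_labelled (fun t u => e u t) gamma)) :> fps.
Proof.
move=> wP; apply/funext=> m.
have sum_tr a : sumn (comp_transpose a) = sumn a.
  by rewrite sumn_comp_rev sumn_comp_compl.
rewrite (labelled_expansion gamma_inj e_irr _ FE sum_tr wP).
rewrite (subst_labelled gamma_inj) // size_extension_pairs; congr (_ *+ _).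
rewrite -[RHS]count_words_rev; apply: eq_in_count => W; rewrite mem_words => /eqP sW.
rewrite extension_word_rev; congr (_ && _).
(* [adapted_word_compl] negates the labels, and reversal has already negated them once. *)
rewrite (_ : lex_le gamma = lex_le (fun t => - - gamma t)); last first.
  by congr lex_le; apply/funext=> t; rewrite opprK.
rewrite -adapted_word_compl ?size_rev //; apply: eq_adapted.
  by rewrite sum_tr sumn_comp_compl !sumn_comp_at size_rev.
apply: descents_comp_transpose; first by rewrite !sumn_comp_at size_rev.
exact: descents_word_comp_rev.
Qed.

End Involutions.

(** * Posets and chains as labelled relations *)

Lemma covers_irr (d : Order.disp_t) (P : finPOrderType d) : irreflexive (@covers d P).
Proof. by move=> t; rewrite /covers ltxx. Qed.

Lemma covers_dual (d : Order.disp_t) (P : finPOrderType d) (t u : P) :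
  covers (t : P^d) (u : P^d) = covers u t.
Proof.
by congr (_ && ~~ _); apply: eq_existsb => v; rewrite andbC.
Qed.

Lemma sv_partitions_dual (d : Order.disp_t) (P : finPOrderType d) (gamma : P -> int) :
  sv_partitions (gamma : P^d -> int) = sv_labelled (fun t u => @covers d P u t) gamma.
Proof.
apply/seteqP; split=> s [s0 se]; split=> // t u.
  by rewrite -covers_dual => /se.
by rewrite covers_dual => /se.
Qed.

Definition succ_rel n : rel 'I_n := fun i j => j == i.+1 :> nat.

Lemma succ_rel_irr n : irreflexive (@succ_rel n).
Proof. by move=> i; rewrite /succ_rel -[X in _ == X]addn1 -[X in X == _]addn0 eqn_add2l. Qed.

(** The length [n] is kept apart from [sumn a], so that labellings of a single chain serve [a] and
    its three transforms. *)
Lemma comp_tuples_labelled (b : Zbeta) (a : composition) n (gamma : 'I_n -> int) :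
    sumn a = n ->
    (forall i j : 'I_n, j = i.+1 :> nat ->
      (gamma j < gamma i) = ((j : nat) \in descents a)) ->
  sv_gf b (comp_tuples a) = sv_gf b (sv_labelled (@succ_rel n) gamma).
Proof.
move=> an; subst n => ga; congr sv_gf; apply/seteqP.
split=> s [s0 se]; split=> // i j.
  by move/eqP=> ij; rewrite (ga i j ij); apply: se.
by move=> ij; rewrite -(ga i j ij); apply/se/eqP.
Qed.

Lemma sv_gf_reindex (b : Zbeta) (T : finType) (h : T -> T) (A : set {ffun T -> {fset nat}}) :
  involutive h -> sv_gf b [set s | A [ffun t => s (h t)]]%classic = sv_gf b A.
Proof.
move=> hK; apply/funext=> m; pose H (s : {ffun T -> {fset nat}}) := [ffun t => s (h t)].
have HK : involutive H by move=> s; apply/ffunP=> t; rewrite !ffunE hK.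
have Hmon s : sv_monomial (H s) = sv_monomial s.
  rewrite /sv_monomial [RHS](reindex_inj (inv_inj hK)).
  by apply: eq_bigr => t _; rewrite ffunE.
rewrite [RHS]/sv_gf (@reindex_fsbig _ _ _ _ _ H [set s | A (H s) /\ sv_monomial s = m]%classic).
  by apply: eq_fsbigr => s _; rewrite -!mdeg_sv_monomial Hmon.
split=> [s [As sm]|s s' _ _|s [As sm]]; first by rewrite /= Hmon.
- exact: inv_inj.
- by exists (H s); rewrite /= ?HK ?Hmon.
Qed.

(** [rev_ord] is an isomorphism from the dual chain to the chain, and permuting the positions of a
    filling changes neither its monomial nor its size. *)
Lemma labelled_succ_rev (b : Zbeta) n (gamma : 'I_n -> int) :
  sv_gf b (sv_labelled (fun i j => @succ_rel n j i) gamma) =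
  sv_gf b (sv_labelled (@succ_rel n) (fun i => gamma (rev_ord i))).
Proof.
rewrite -(sv_gf_reindex _ _ (@rev_ordK n)); congr sv_gf.
have rev_succ i j : succ_rel (rev_ord j) (rev_ord i) = @succ_rel n i j.
  by rewrite /succ_rel /= subnSK // eqn_sub2lE ?(ltnW (ltn_ord j)) // eq_sym.
apply/seteqP; split=> s [s0 se]; split=> [t|t u etu].
- by have := s0 (rev_ord t); rewrite ffunE rev_ordK.
- by have := se (rev_ord t) (rev_ord u); rewrite !ffunE !rev_ordK rev_succ; apply.
- by rewrite ffunE.
- by have := se (rev_ord t) (rev_ord u); rewrite !ffunE !rev_ordK -rev_succ !rev_ordK; apply.
Qed.

(* On consecutive indices the order of the labels is decided by the sign of the larger
   one, so any set of positions is the descent set of a chain; the absolute values make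
   the labelling injective. *)
Definition sign_label n (D : pred nat) (i : 'I_n) : int := if D i then - i%:Z else i%:Z.
Arguments sign_label n D i : clear implicits.

Lemma sign_label_inj n D : injective (sign_label n D).
Proof.
move=> i j /(congr1 (fun x : int => `|x|%N)); rewrite /sign_label => ij; apply: val_inj.
by move: ij; do 2!case: (D _); rewrite ?abszN !absz_nat.
Qed.

Lemma sign_label_lt n D (i j : 'I_n) :
  j = i.+1 :> nat -> (sign_label n D j < sign_label n D i) = D j.
Proof.
move=> ij; rewrite /sign_label ij; case: (D i.+1); case: (D i).
- by rewrite ltrN2 ltz_nat ltnSn.
- by rewrite (@lt_le_trans _ _ 0) // oppr_lt0.
- by apply/negbTE; rewrite -leNgt (@le_trans _ _ 0) // oppr_le0.
- by rewrite ltz_nat ltnNge leqnSn.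
Qed.

Theorem proposition6p2
  (omega psi rho : {linear mQSym -> mQSym})
  (omegaP : continuous_extension comp_transpose omega)
  (psiP : continuous_extension comp_compl psi)
  (rhoP : continuous_extension comp_rev rho)
  (a : composition)
  (d : Order.disp_t) (P : finPOrderType d) (gamma : P -> int)
  (gamma_inj : injective gamma) :
  [/\ omega (multifundamental beta a) =
        fps_subst geom_var (multifundamental beta (comp_transpose a)) :> fps,
      psi (multifundamental beta a) =
        fps_subst geom_var (multifundamental beta (comp_compl a)) :> fps
    & rho (multifundamental beta a) = multifundamental beta (comp_rev a)] /\
  [/\ omega (Gamma beta gamma) =
        fps_subst geom_var (Gamma beta (gamma : P^d -> int)) :> fps,
      psi (Gamma beta gamma) =
        fps_subst geom_var (Gamma beta (fun s => - gamma s)) :> fps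
    & rho (Gamma beta gamma) = Gamma beta (fun s : P^d => - gamma s)].
Proof.
pose n := sumn a; pose D := mem (descents a).
pose g := @sign_label n D; have g_inj := @sign_label_inj n D.
(* Injectivity of the labels turns a non-descent into a strict ascent, as needed after negating or
   reversing. *)
have g_lt (i j : 'I_n) : j = i.+1 :> nat -> (g i < g j) = ((j : nat) \notin descents a).
  move=> ij; rewrite -[RHS]/(~~ D j) -(sign_label_lt D ij) -leNgt lt_neqAle.
  by rewrite (inj_eq g_inj) -(inj_eq val_inj) /= ij (ltn_eqF (ltnSn _)).
have aE : (multifundamental beta a : fps) = sv_gf beta (sv_labelled (@succ_rel n) g).
  by apply: comp_tuples_labelled => // i j; apply: sign_label_lt.
have succ_bound (i j : 'I_n) : j = i.+1 :> nat -> (0 < j < sumn a)%N.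
  by move=> ij; rewrite (ltn_ord j : (j < sumn a)%N) ij.
(* The reflected descent position n - j is the index [rev_ord i], which is the successor of
   [rev_ord j] in the reversed chain. *)
have rev_succ (i j : 'I_n) : j = i.+1 :> nat ->
    (rev_ord i : nat) = (rev_ord j).+1 /\ (n - j)%N = rev_ord i.
  by move=> ij; rewrite /= ij subnSK // -ij.
have e_irr := @succ_rel_irr n.
have PE : (Gamma beta gamma : fps) = sv_gf beta (sv_labelled (@covers d P) gamma) by [].
have c_irr := @covers_irr d P.
split; split.
- rewrite (transpose_labelled g_inj e_irr aE omegaP) labelled_succ_rev.
  congr fps_subst; symmetry; apply: comp_tuples_labelled.
    by rewrite sumn_comp_rev sumn_comp_compl.
  move=> i j ij; have [ij' jE] := rev_succ i j ij.
  rewrite g_lt // mem_descents_rev sumn_comp_compl mem_descents_compl jE.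
  by rewrite (succ_bound i) // (succ_bound _ _ ij').
- rewrite (compl_labelled g_inj e_irr aE psiP).
  congr fps_subst; symmetry; apply: comp_tuples_labelled; first exact: sumn_comp_compl.
  by move=> i j ij; rewrite ltrN2 g_lt // mem_descents_compl (succ_bound i).
- apply: val_inj; rewrite -[LHS]/(rho _ : fps) (rev_labelled g_inj e_irr aE rhoP).
  rewrite labelled_succ_rev; symmetry; apply: comp_tuples_labelled; first exact: sumn_comp_rev.
  move=> i j ij; have [ij' jE] := rev_succ i j ij.
  by rewrite ltrN2 sign_label_lt // mem_descents_rev jE (succ_bound i).
- by rewrite (transpose_labelled gamma_inj c_irr PE omegaP) -sv_partitions_dual.
- by rewrite (compl_labelled gamma_inj c_irr PE psiP).
- apply: val_inj; rewrite -[LHS]/(rho _ : fps) (rev_labelled gamma_inj c_irr PE rhoP).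
  by rewrite -sv_partitions_dual.
Qed.
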